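(* Let $d\geq1$ and $m\geq2$ be integers, let $\pi\in NC^*(d,m)$, and let $a=(a_k)_{k\in\mathbb{N}^d}$ be a finitely supported family of complex $\alpha\times\alpha$ matrices with associated block-matrices $M_0,\dots,M_d$. Then $$|S(a,\pi,d,m)|\leq\prod_{l=0}^d\|M_l\|_{2m}^{2m\mu_l},\qquad \mu_l=\frac{B(\pi|_{A_{l+1}})-B(\pi|_{A_l})}{m-1},$$ with the conventions $B(\pi|_{A_0})=1$ and $B(\pi|_{A_{d+1}})=m$.
   Context: For an integer $n$, $[n]=\{1,\dots,n\}$. For a partition $\pi$, $i\sim_\pi j$ means $i$ and $j$ lie in the same block. A partition of $[n]$ is non-crossing if for distinct $i<j<k<l$, $i\sim_\pi k$ and $j\sim_\pi l$ imply $i\sim_\pi j$. The set $[2dm]$ is divided into $2m$ intervals $J_k=\{(k-1)d+1,\dots,kd\}$, $1\leq k\leq2m$. The elements of $J_k$ are labelled in order from $1$ to $d$ if $k$ is odd and from $d$ to $1$ if $k$ is even; $A_i$ is the set of elements of $[2dm]$ with label $i$ ($1\leq i\leq d$). $NC^*(d,m)$ is the set of non-crossing partitions of $[2dm]$ all of whose blocks have even cardinality and such that within each block any two consecutive elements belong to intervals $J_k,J_{k'}$ with $k\not\equiv k'\pmod2$. Each $\pi\in NC^*(d,m)$ connects only elements with the same label, so it restricts to partitions $\pi|_{A_i}$; identifying $A_i$ with $[2m]$ (the element of $A_i\cap J_k$ corresponds to $k$), $\pi|_{A_i}\in NC^*(1,m)$, the set of non-crossing partitions of $[2m]$ with blocks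 of even size. For $\rho\in NC^*(1,m)$, $\Phi(\rho)$ is the partition of $[m]$ obtained by identifying $2k-1$ and $2k$ in $[2m]$ to get $k\in[m]$: $\sim_{\Phi(\rho)}$ is the transitive closure of the relation relating $k$ and $l$ if some element of $\{2k-1,2k\}$ is $\sim_\rho$ some element of $\{2l-1,2l\}$. $B(\rho)$ is the number of blocks of $\Phi(\rho)$. For $k=(k(1),\dots,k(d))\in\mathbb{N}^d$, $\widetilde a_k=a_{(k(d),\dots,k(1))}$. For $k\in\mathbb{N}^{2dm}$, $k\prec\pi$ means $k_i=k_j$ whenever $i\sim_\pi j$. Identifying $(\mathbb{N}^d)^{2m}$ with $\mathbb{N}^{2dm}$, $$S(a,\pi,d,m)=\sum_{k_1,\dots,k_{2m}\in\mathbb{N}^d,\ (k_1,\dots,k_{2m})\prec\pi}Tr(a_{k_1}\widetilde a_{k_2}^*a_{k_3}\widetilde a_{k_4}^*\cdots a_{k_{2m-1}}\widetilde a_{k_{2m}}^* ).$$ $M_l$ ($0\leq l\leq d$) is the finite rank operator from $\mathbb{C}^\alpha\otimes\ell^2(\mathbb{N})^{\otimes(d-l)}$ to $\mathbb{C}^\alpha\otimes\ell^2(\mathbb{N})^{\otimes l}$ whose block with row index $s\in\mathbb{N}^l$ and column index $t\in\mathbb{N}^{d-l}$ is $a_{(s,t)}$, and $\|M_l\|_{2m}=Tr((M_l^*M_l)^m)^{1/(2m)}$ is its Schatten $2m$-norm. Convention: $0^0=1$. *)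

(* Defs.v *)
From HB Require Import structures.
From mathcomp Require Import all_boot all_order all_algebra all_field.
From mathcomp Require Import complex.
From mathcomp Require Import all_classical all_reals exp.

Set Implicit Arguments.
Unset Strict Implicit.
Unset Printing Implicit Defensive.

Import Order.TTheory GRing.Theory Num.Theory.

(* A partition of a finite type T is a P : {set {set T}} such that
   finset.partition P [set: T]. *)

Definition sim (T : finType) (P : {set {set T}}) : rel T :=
  fun x y => [exists B in P, (x \in B) && (y \in B)].

Definition noncrossing (n : nat) (P : {set {set 'I_n}}) : Prop :=
  forall i j k l : 'I_n, i < j -> j < k -> k < l ->
    sim P i k -> sim P j l -> sim P i j.

(* i and j are consecutive elements of the block B, with i before j *)
Definition consecutive (n : nat) (B : {set 'I_n}) (i j : 'I_n) : Prop :=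
  [/\ i \in B, j \in B, i < j & forall x, x \in B -> ~~ (i < x < j)].

(* Positions and intervals are numbered from 0: 'I_(2 * d * m) stands for
   [2dm] via p |-> p + 1, and p lies in J_(p %/ d + 1).  Labels are numbered
   from 1 to d, hence label 0 is free. *)
Definition interval_index (d m : nat) (p : 'I_(2 * d * m)) : nat := p %/ d.

Definition label (d m : nat) (p : 'I_(2 * d * m)) : nat :=
  if odd (interval_index p) then d - p %% d else (p %% d).+1.

Definition A_ (d m i : nat) : {set 'I_(2 * d * m)} := [set p | label p == i].

Definition NCstar (d m : nat) (P : {set {set 'I_(2 * d * m)}}) : Prop :=
  [/\ finset.partition P [set: 'I_(2 * d * m)],
      noncrossing P,
      forall B, B \in P -> ~~ odd #|B|
    & forall B i j, B \in P -> consecutive B i j ->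
        odd (interval_index i) != odd (interval_index j)].

(* The restriction of P to A_i, transported to [2m] by sending the element of
   A_i lying in the k-th interval to k. *)
Definition restr (d m : nat) (P : {set {set 'I_(2 * d * m)}}) (i : nat) :
    {set {set 'I_(2 * m)}} :=
  [set [set k : 'I_(2 * m) |
          [exists p in B :&: A_ d m i, interval_index p == k]] | B in P]
  :\ finset.set0.

(* x is one of the two elements of 'I_(2 * m) merged into k iff x./2 = k. *)
Definition Phi_rel (m : nat) (rho : {set {set 'I_(2 * m)}}) : rel 'I_m :=
  fun k l => [exists x : 'I_(2 * m), exists y : 'I_(2 * m),
    [&& x./2 == k :> nat, y./2 == l :> nat & sim rho x y]].

Definition Phi (m : nat) (rho : {set {set 'I_(2 * m)}}) : {set {set 'I_m}} :=
  equivalence_partition (connect (Phi_rel rho)) [set: 'I_m].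

Definition Bnum (m : nat) (rho : {set {set 'I_(2 * m)}}) : nat := #|Phi rho|.

(* B(pi|_(A_l)) for 0 <= l <= d + 1, with the two boundary conventions *)
Definition Bres (d m : nat) (P : {set {set 'I_(2 * d * m)}}) (l : nat) : nat :=
  if l == 0 then 1 else if l == d.+1 then m else Bnum (restr P l).

Local Open Scope ring_scope.
Local Open Scope classical_set_scope.
Local Open Scope sesquilinear_scope.

(* Matrices with rows indexed by I, columns by J and entries in 'M_n, i.e.
   operators from C^n (x) l^2(J) to C^n (x) l^2(I).  The sums over
   [set: J] below are sums over the support of the summand; they are 0 by
   convention when that support is infinite, which cannot happen for matrices
   with finitely many nonzero blocks. *)
Section BlockMatrix.
Variables (C : numClosedFieldType) (n : nat).

Definition blockmx (I J : Type) := I -> J -> 'M[C]_n.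

Definition bmul (I K : Type) (J : choiceType)
    (X : blockmx I J) (Y : blockmx J K) : blockmx I K :=
  fun i k => \sum_(j \in [set: J]) (X i j *m Y j k).

Definition badj (I J : Type) (X : blockmx I J) : blockmx J I :=
  fun j i => (X i j) ^t*.

Definition bid (I : choiceType) : blockmx I I :=
  fun i j => if i == j then 1%:M else 0.

Definition bexp (I : choiceType) (X : blockmx I I) (m : nat) : blockmx I I :=
  iter m (bmul X) (@bid I).

Definition btr (I : choiceType) (X : blockmx I I) : C :=
  \sum_(i \in [set: I]) \tr (X i i).

End BlockMatrix.

(* Tr((X^* X)^m)^(1/(2m)); the trace is a nonnegative real, so taking its real
   part only changes its type. *)
Definition schatten2 (R : realType) (n : nat) (I J : choiceType)
    (X : blockmx R[i] n I J) (m : nat) : R :=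
  complex.Re (btr (bexp (bmul (badj X) X) m)) `^ (2 * m%:R)^-1.

Section Family.
Variables (C : numClosedFieldType) (alpha d : nat).
Variable a : d.-tuple nat -> 'M[C]_alpha.

Definition M_ (l : 'I_d.+1) :
    blockmx C alpha (l.-tuple nat) ((d - l).-tuple nat) :=
  fun s t => a (tcast (subnKC (leq_ord l)) [tuple of s ++ t]).

Definition atilde (k : d.-tuple nat) : 'M[C]_alpha := a [tuple of rev k].

(* (N^d)^(2m) is identified with N^(2dm) by concatenation. *)
Definition compat (m : nat) (k : (2 * m).-tuple (d.-tuple nat))
    (P : {set {set 'I_(2 * d * m)}}) : Prop :=
  let kk := flatten [seq val x | x <- k] in
  forall i j : 'I_(2 * d * m), sim P i j -> nth 0%N kk i = nth 0%N kk j.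

(* Indices start from 0, so the starred factors are the odd ones. *)
Definition S_ (m : nat) (P : {set {set 'I_(2 * d * m)}}) : C :=
  \sum_(k \in [set k : (2 * m).-tuple (d.-tuple nat) | compat k P])
    \tr (\prod_(j < 2 * m)
           if odd j then (atilde (tnth k j)) ^t* else a (tnth k j)).

End Family.

Arguments M_ {C alpha d} a l s t.

Definition mu (R : realType) (d m : nat) (P : {set {set 'I_(2 * d * m)}})
    (l : nat) : R :=
  ((Bres P l.+1)%:R - (Bres P l)%:R) / (m%:R - 1).

(* Main.v *)
Require Import Defs.
From HB Require Import structures.
From mathcomp Require Import all_boot all_order all_algebra all_field.
From mathcomp Require Import complex.
From mathcomp Require Import zify lra.
From mathcomp Require Import all_classical all_reals exp.

Set Implicit Arguments.
Unset Strict Implicit.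
Unset Printing Implicit Defensive.

Import Order.TTheory GRing.Theory Num.Theory.

(** The inequality follows from the Cauchy-Schwarz inequality, iterated through an
    extremal principle.

    A partition in NC*(d, m) joins only equal labels (sim_label), so it is the same
    thing as a family E of d equivalence relations on the 2m intervals, placed on a
    cycle.  Each E i is alternating: cyclically consecutive elements of a block have
    opposite parities; and the relations of two labels do not cross.  The number
    B of the restriction to a label is the number of blocks whose smallest
    interval is an odd one, that is, has an even index when counting from 0
    (Bnum_nb_open).

    Cut the cycle into two halves.  A word a_(k_1) a_(k_2)^* ... of length 2m is a
    product X Y^* of two words of length m, where Y is read from the mirror image of
    the second half, and Cauchy-Schwarz bounds |S(E)|^2 by S(E') S(E''), where E' and
    E'' are obtained by reflecting either half of E onto the other
    (wordsum_cauchy_schwarz).  This symmetrization preserves alternation and the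
    absence of crossings, and the numbers of blocks counted above satisfy
    B(E') + B(E'') = 2 B(E) (nb_open_mirror).  Hence the right-hand side of the
    theorem, which is geometric in these numbers, satisfies the same relation with an
    equality, and if the ratio of |S| to the bound is maximal at E it is maximal at E'
    and E'' too.  Moreover, if the cut is made just before a matrix without adjoint and
    the two intervals on either side of it are in the same block of E', they can be
    split off as a block of their own: B is unchanged (nb_open_isolate) and S can only
    grow, being a sum of squares (wordsum_isolate).

    Among the families that maximize the ratio, choose one for which the number of
    elements lying in a block formed by two neighbours is maximal.  Were there any
    other block, rotating the cycle and symmetrizing would increase that number
    (gain_isolate, gain_last).  So all blocks are pairs of neighbours; as labels do not
    cross, for some l the labels up to l are paired one way around the cycle and those
    beyond l the other way (terminal_shape), and for this family S is the trace of
    the m-th power of the positive operator built from M_l (wordsum_terminal), which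
    is exactly the bound (interpolation_step). *)

(** * Alternating relations and reflections of a cycle *)

(* Linear arithmetic on the values of ordinals, forgetting the context. *)
Ltac ord_lia :=
  repeat match goal with |- context [nat_of_ord ?x] =>
    let k := fresh "k" in move: (nat_of_ord x) => k end;
  clear; lia.

Section Reflection.
Variable m : nat.
Local Notation n := (2 * m)%N.
Implicit Types (r : rel 'I_n) (x y z : 'I_n) (s e : bool).

(** Equivalence relations, as a conjunction of the three usual properties. *)
Definition is_equiv (T : Type) (r : rel T) : Prop :=
  [/\ reflexive r, symmetric r & transitive r].

(** z lies strictly inside the arc that goes from x to y in the increasing cyclic
    order; when x = y the arc is the whole cycle except x. *)
Definition btw (x z y : nat) : bool :=
  (x < z < y) || ((y <= x) && ((x < z) || (z < y))).

Lemma btw_low k (x y z z' : nat) : x < k -> y < k -> k <= z -> k <= z' ->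
  btw x z y = btw x z' y.
Proof. by rewrite /btw => *; case: (ltnP x y) => ?; lia. Qed.

Lemma btw_high k (x y z z' : nat) : k <= x -> k <= y -> z < k -> z' < k ->
  btw x z y = btw x z' y.
Proof. by rewrite /btw => *; case: (ltnP x y) => ?; lia. Qed.

Lemma rev_lt (x y : 'I_n) : (rev_ord x < rev_ord y) = (y < x).
Proof. by rewrite /= ltn_sub2lE. Qed.

Lemma rev_le (x y : 'I_n) : (rev_ord x <= rev_ord y) = (y <= x).
Proof. by rewrite leqNgt rev_lt -leqNgt. Qed.

Lemma btw_rev (x y z : 'I_n) : btw (rev_ord x) (rev_ord z) (rev_ord y) = btw y z x.
Proof. by rewrite /btw !rev_lt !rev_le (andbC (z < x)) (orbC (z < x)). Qed.

(** Cyclically consecutive elements of a block have opposite parities: on any arc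
    between two elements of the same parity there is one of the other parity.  The
    case x = y excludes singletons and blocks of odd size. *)
Definition alternating r : Prop := forall x y, r x y -> odd x = odd y ->
  exists z, [/\ r x z, odd z != odd x & btw x z y].

(** x is the smallest (below: the largest) element of its block. *)
Definition block_min r x := [forall y : 'I_n, (y < x) ==> ~~ r y x].
Definition block_max r x := [forall y : 'I_n, (x < y) ==> ~~ r y x].

(** The number of blocks whose minimum has parity e, corrected by e so that it is
    invariant under rotations of the cycle (see nb_open_rot).  The parity e is that
    of the positions carrying a matrix without adjoint. *)
Definition nb_open e r : nat :=
  \sum_(x : 'I_n) ((odd x == e) && block_min r x) + e.

Lemma rev_val x : rev_ord x = (n - x.+1)%N :> nat. Proof. by []. Qed.

Lemma odd_rev x : odd (rev_ord x) = ~~ odd x.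
Proof. have := ltn_ord x; rewrite rev_val; lia. Qed.

(** The two halves of the cycle: the lower half for s = true, the upper one for
    s = false.  They are exchanged by the reflection rev_ord. *)
Definition inside s x := if s then x < m else m <= x.

Lemma inside_rev s x : inside s (rev_ord x) = ~~ inside s x.
Proof. have := ltn_ord x; rewrite /inside rev_val; case: s => /=; lia. Qed.

(** The representative of x or of its mirror image in the half s. *)
Definition pull s x : 'I_n := if inside s x then x else rev_ord x.

Lemma inside_pull s x : inside s (pull s x).
Proof. by rewrite /pull; case: (boolP (inside s x)) => // h; rewrite inside_rev. Qed.

Lemma pull_rev s x : pull s (rev_ord x) = pull s x.
Proof. by rewrite /pull inside_rev; by case: (inside s x); rewrite ?rev_ordK. Qed.

Lemma pull_in s x : inside s x -> pull s x = x.
Proof. by rewrite /pull => ->. Qed.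

Lemma pull_out s x : ~~ inside s x -> pull s x = rev_ord x.
Proof. by rewrite /pull => /negbTE ->. Qed.

(** The block of x is not contained in the half s. *)
Definition crosses s r x := [exists z, r x z && ~~ inside s z].

(** The symmetrization of r along the half s: a block contained in that half is
    duplicated, a block that leaves it is cut and glued to its mirror image, and the
    rest of r is forgotten. *)
Definition mirror s r : rel 'I_n := fun x y =>
  r (pull s x) (pull s y) && ((inside s x == inside s y) || crosses s r (pull s x)).

Lemma crossesP s r x : reflect (exists2 z, r x z & ~~ inside s z) (crosses s r x).
Proof.
apply: (iffP existsP) => [[z /andP[]]|[z h1 h2]]; first by exists z.
by exists z; rewrite h1.
Qed.

Lemma eq_crosses s r x y : is_equiv r -> r x y -> crosses s r x = crosses s r y.
Proof.
case=> _ sr tr; move=> xy.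
apply/crossesP/crossesP => -[z h1 h2]; exists z => //; apply: tr h1 => //.
by rewrite sr.
Qed.

Lemma mirror_equiv s r : is_equiv r -> is_equiv (mirror s r).
Proof.
move=> er; have [rr sr tr] := er; split.
- by move=> x; rewrite /mirror rr eqxx.
- move=> x y; rewrite /mirror [r (pull s y) _]sr.
  have [xy|//] := boolP (r (pull s x) (pull s y)).
  by rewrite (eq_crosses s er xy) eq_sym.
- move=> y x z /andP[xy cxy] /andP[yz cyz]; rewrite /mirror (tr _ _ _ xy yz) /=.
  move: cxy cyz; rewrite -(eq_crosses s er xy).
  by case: (crosses _ _ _); rewrite ?orbT ?orbF // => /eqP -> /eqP ->.
Qed.

Lemma mirror_rev s r x y : mirror s r (rev_ord x) (rev_ord y) = mirror s r x y.
Proof.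
rewrite /mirror !pull_rev !inside_rev.
by case: (inside s x); case: (inside s y).
Qed.

Lemma mirror_in s r x y : inside s x -> inside s y -> mirror s r x y = r x y.
Proof. by move=> hx hy; rewrite /mirror !pull_in // hx hy andbT. Qed.

Lemma mirror_self s r x : is_equiv r -> inside s x ->
  mirror s r x (rev_ord x) = crosses s r x.
Proof.
case=> rr _ _ hx; rewrite /mirror pull_rev pull_in // inside_rev hx rr /=.
by [].
Qed.

Lemma btw_side s x y z z' : inside s x -> inside s y ->
  ~~ inside s z -> ~~ inside s z' -> btw x z y = btw x z' y.
Proof.
by rewrite /inside; case: s; rewrite -?leqNgt -?ltnNge; [apply: btw_low|apply: btw_high].
Qed.

Lemma btw_rev_or s x y : inside s x -> inside s y -> x != y ->
  (btw x y (rev_ord y) || btw x (rev_ord x) (rev_ord y)) &&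
  (btw (rev_ord x) x y || btw (rev_ord x) (rev_ord y) y).
Proof.
have key (u v a b : nat) : (if s then u < a else a < u) ->
    (if s then v < b else b < v) -> (a < b) = (v < u) -> (b < a) = (u < v) ->
    u != v -> (btw u v b || btw u a b) && (btw a u v || btw a b v).
  rewrite neq_ltn /btw => hu hv e e' /orP[] h;
    [move: e' e|move: e e']; rewrite h => h' _; case: s hu hv => /= hu hv; lia.
move=> hx hy; rewrite -val_eqE; apply: key; rewrite ?rev_lt //.
  by move: hx; rewrite /inside rev_val; have := ltn_ord x; case: s {hy} => /=; lia.
by move: hy; rewrite /inside rev_val; have := ltn_ord y; case: s {hx} => /=; lia.
Qed.

Lemma mirror_alt s r : is_equiv r -> alternating r -> alternating (mirror s r).
Proof.
move=> er ar.
have [rr sr tr] := er; have [rr' sr' tr'] := mirror_equiv s er.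
(* A witness given by r for two points of the half s serves unless it is outside
   this half, in which case the mirror image of x does. *)
have same x y : inside s x -> inside s y -> r x y -> odd x = odd y ->
    exists z, [/\ mirror s r x z, odd z != odd x & btw x z y].
  move=> hx hy rxy oxy; have [z [xz oz bz]] := ar x y rxy oxy.
  have [hz|hz] := boolP (inside s z); first by exists z; rewrite mirror_in.
  exists (rev_ord x); split; last 1 first.
  - by rewrite -(btw_side hx hy hz) // inside_rev hx.
  - by rewrite mirror_self //; apply/crossesP; exists z.
  - by rewrite odd_rev; case: (odd x).
(* When the arc ends at the mirror image of y, either y or the mirror image of x
   lies on it, and both have the parity opposite to that of x. *)
have diff x y : inside s x -> inside s y -> r x y -> crosses s r x ->
    odd x != odd y -> exists z, [/\ mirror s r x z, odd z != odd x & btw x z (rev_ord y)].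
  move=> hx hy rxy cx oxy.
  have nxy : x != y by apply: contraNneq oxy => ->.
  have /andP[/orP[b|b] _] := btw_rev_or hx hy nxy; first by exists y; rewrite mirror_in // eq_sym.
  by exists (rev_ord x); rewrite mirror_self // odd_rev; split => //; case: (odd x).
move=> x y xy oxy.
have [hx|hx] := boolP (inside s x); have [hy|hy] := boolP (inside s y).
- by apply: same => //; rewrite -(mirror_in r hx hy).
- have hy' : inside s (rev_ord y) by rewrite inside_rev.
  have := xy; rewrite {1}/mirror (negbTE hy) hx (pull_in hx) (pull_out hy) => /andP[rxy cx].
  have := diff x (rev_ord y) hx hy' rxy cx; rewrite rev_ordK; apply.
  by rewrite odd_rev oxy; case: (odd y).
- have hx' : inside s (rev_ord x) by rewrite inside_rev.
  have := xy; rewrite {1}/mirror (negbTE hx) hy (pull_in hy) (pull_out hx) => /andP[rxy cx].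
  have oxy' : odd (rev_ord x) != odd y by rewrite odd_rev oxy; case: (odd y).
  have nxy : rev_ord x != y by apply: contraNneq oxy' => ->.
  have /andP[_] := btw_rev_or hx' hy nxy; rewrite rev_ordK => /orP[b|b].
    exists (rev_ord x); rewrite sr' -{2}(rev_ordK x) mirror_self //.
    by split=> //; rewrite odd_rev; case: (odd x).
  exists (rev_ord y); rewrite -mirror_rev rev_ordK mirror_in //.
  by rewrite odd_rev oxy; split=> //; case: (odd y).
- have [||||z [xz oz bz]] := same (rev_ord y) (rev_ord x).
  + by rewrite inside_rev.
  + by rewrite inside_rev.
  + by rewrite -(@mirror_in s) ?inside_rev // mirror_rev sr'.
  + by rewrite !odd_rev oxy.
  exists (rev_ord z); split.
  + apply: (tr' y) => //; rewrite -mirror_rev rev_ordK //.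
  + by move: oz; rewrite !odd_rev oxy; case: (odd y); case: (odd z).
  + by rewrite -[x]rev_ordK -[y]rev_ordK btw_rev.
Qed.

End Reflection.

(** * Counting blocks by the parity of their minimum *)

Section BlockMinima.
Variable m : nat.
Local Notation n := (2 * m)%N.
Implicit Types (r : rel 'I_n) (x y z : 'I_n) (s e : bool).

Lemma block_minP r x : reflect (forall y, r y x -> x <= y) (block_min r x).
Proof.
apply: (iffP forallP) => h y; first by rewrite leqNgt; move: (h y); case: (y < x) => //= /negP.
by apply/implyP=> yx; apply/negP => /h; rewrite leqNgt yx.
Qed.

Lemma block_maxP r x : reflect (forall y, r y x -> y <= x) (block_max r x).
Proof.
apply: (iffP forallP) => h y; first by rewrite leqNgt; move: (h y); case: (x < y) => //= /negP.
by apply/implyP=> yx; apply/negP => /h; rewrite leqNgt yx.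
Qed.

Lemma sum_pred1 (T : finType) (x0 : T) : \sum_(x : T) (x == x0) = 1.
Proof. by rewrite (bigD1 x0) //= eqxx big1 // => x /negbTE ->. Qed.

Lemma unique_max r x : is_equiv r -> \sum_y (r x y && block_max r y) = 1.
Proof.
move=> [rr sr tr].
have [y0 xy0 max] := @arg_maxnP _ x (r x) (fun y => y : nat) (rr x).
rewrite -[RHS](sum_pred1 y0); apply: eq_bigr => y _; congr nat_of_bool; apply/andP/eqP.
  case=> xy /block_maxP my; apply/val_inj/eqP; rewrite eqn_leq; apply/andP; split; [exact: max|apply: my].
  by apply: tr xy; rewrite sr.
by move=> ->; split=> //; apply/block_maxP => y' y'y; apply: (max y'); apply: tr xy0 _; rewrite sr.
Qed.

Lemma unique_min r x : is_equiv r -> \sum_y (r y x && block_min r y) = 1.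
Proof.
move=> [rr sr tr].
have [y0 xy0 min] := @arg_minnP _ x (r^~ x) (fun y => y : nat) (rr x).
rewrite -[RHS](sum_pred1 y0); apply: eq_bigr => y _; congr nat_of_bool; apply/andP/eqP.
  case=> xy /block_minP my; apply/val_inj/eqP; rewrite eqn_leq; apply/andP; split; [apply: my|exact: min].
  by apply: tr xy0 _; rewrite sr.
by move=> ->; split=> //; apply/block_minP => y' y'y; apply: (min y'); apply: tr xy0.
Qed.

(** The arc from the maximum to the minimum of a block contains no other element of
    the block, hence these two elements have opposite parities. *)
Lemma odd_min_max r x y : is_equiv r -> alternating r ->
  block_min r x -> block_max r y -> r x y -> odd y = ~~ odd x.
Proof.
move=> [rr sr tr] ar /block_minP mx /block_maxP my xy.
case: (eqVneq (odd y) (odd x)) => [oxy|]; last by case: (odd x); case: (odd y).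
have [|z [yz _]] := ar y x _ oxy; first by rewrite sr.
have := my z; have := mx z; rewrite (sr z x) (tr _ _ _ xy yz) (sr z y) yz /btw.
by move=> /(_ isT) h1 /(_ isT) h2; lia.
Qed.

(** Double counting of the pairs (minimum, maximum) of a block. *)
Lemma sum_min_max e r : is_equiv r -> alternating r ->
  \sum_(x : 'I_n) ((odd x == e) && block_min r x) = \sum_(x : 'I_n) ((odd x == ~~ e) && block_max r x).
Proof.
move=> er ar.
pose F (x y : 'I_n) : nat := [&& odd x == e, block_min r x, r x y & block_max r y].
transitivity (\sum_x \sum_y F x y).
  apply: eq_bigr => x _; rewrite -[LHS]muln1 -[X in _ * X = _](unique_max x er) big_distrr /=.
  by apply: eq_bigr => y _; rewrite mulnb /F !andbA.
rewrite exchange_big; apply: eq_bigr => y _ /=.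
rewrite -[RHS]muln1 -[X in _ = _ * X](unique_min y er) big_distrr /=; apply: eq_bigr => x _.
rewrite mulnb /F; congr nat_of_bool.
have [mx|] := boolP (block_min r x); last by rewrite !andbF.
have [my|] := boolP (block_max r y); last by rewrite !andbF.
have [xy|] := boolP (r x y); last by rewrite !andbF.
by rewrite !andbT (odd_min_max er ar mx my xy) {F}; case: (odd x); case: e.
Qed.

Lemma lt_side s x z : inside s x -> ~~ inside s z -> (x < z) = s.
Proof. by rewrite /inside; case: s => /=; lia. Qed.

Lemma mirror_out s r x y : ~~ inside s x -> ~~ inside s y ->
  mirror s r x y = r (rev_ord x) (rev_ord y).
Proof. by move=> hx hy; rewrite -mirror_rev mirror_in // inside_rev ?hx ?hy. Qed.

Lemma mirror_in_out s r x y : is_equiv r -> inside s x -> ~~ inside s y ->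
  mirror s r x y = r x (rev_ord y) && crosses s r x.
Proof. by move=> er hx hy; rewrite /mirror (negbTE hy) hx pull_in // pull_out. Qed.

Lemma mirror_min_in s r x : is_equiv r -> inside s x ->
  block_min (mirror s r) x = block_min r x.
Proof.
move=> er hx; have [rr sr tr] := er; have [_ sr' _] := mirror_equiv s er.
apply/block_minP/block_minP => h y yx.
- have [hy|hy] := boolP (inside s y); first by apply: h; rewrite mirror_in.
  have ys := lt_side hx hy; case: s hx hy ys h sr' => hx hy ys h _; first exact: ltnW.
  have /h : mirror false r (rev_ord x) x.
    have [_ -> _] := mirror_equiv false er; rewrite mirror_self //.
    by apply/crossesP; exists y => //; rewrite sr.
  by rewrite leqNgt rev_val; move: hx; rewrite /inside; have := ltn_ord x; lia.
- have [hy|hy] := boolP (inside s y); first by apply: h; rewrite -(@mirror_in _ s).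
  move: yx; rewrite sr' mirror_in_out // => /andP[_ /crossesP[z xz hz]].
  have := h z; rewrite sr xz => /(_ isT); rewrite leq_eqVlt => /orP[/eqP/val_inj xz'|].
    by rewrite -xz' hx in hz.
  by rewrite (lt_side hx hz) -(lt_side hx hy) => /ltnW.
Qed.

Lemma mirror_min_out s r x : is_equiv r -> ~~ inside s x ->
  block_min (mirror s r) x = block_max r (rev_ord x).
Proof.
move=> er hx; have [rr sr tr] := er; have [_ sr' _] := mirror_equiv s er.
have hx' : inside s (rev_ord x) by rewrite inside_rev.
have flip : rev_ord x < x = s by apply: lt_side.
apply/block_minP/block_maxP => h y yx.
- have [hy|hy] := boolP (inside s y).
    by rewrite -[y]rev_ordK rev_le; apply: h; rewrite mirror_out ?inside_rev ?hy // rev_ordK.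
  have ys := lt_side hx' hy; case: s hx hx' hy ys flip h sr' => hx hx' hy ys flip h sr'.
    have /h : mirror true r (rev_ord x) x.
      rewrite -{2}[x]rev_ordK mirror_self //.
      by apply/crossesP; exists y => //; rewrite sr.
    by rewrite leqNgt flip.
  by rewrite leqNgt ys.
- have [hy|hy] := boolP (inside s y); last first.
    by rewrite -rev_le; apply: h; rewrite -(@mirror_out s).
  move: yx; rewrite mirror_in_out // => /andP[yx /crossesP[z yz hz]].
  have xz : r z (rev_ord x) by rewrite sr; apply: tr yz; rewrite sr.
  have := h z xz; rewrite leqNgt (lt_side hx' hz) => ns.
  by rewrite leqNgt (lt_side hy hx).
Qed.

(** The minima of the two symmetrized relations correspond to the minima of r and
    to the mirror images of its maxima, the reflection exchanging parities. *)
Lemma nb_open_mirror e r : is_equiv r -> alternating r ->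
  nb_open e (mirror true r) + nb_open e (mirror false r) = 2 * nb_open e r.
Proof.
move=> er ar; rewrite /nb_open addnACA [RHS]mul2n -[RHS]addnn [RHS]addnACA; congr (_ + _).
rewrite [X in _ = _ + X]sum_min_max // [X in _ = _ + X](reindex_inj rev_ord_inj) /=.
rewrite -!big_split; apply: eq_bigr => x _ /=.
have -> : (odd (n - x.+1) == ~~ e) = (odd x == e).
  by rewrite -rev_val odd_rev; case: (odd x); case: e.
have [hx|hx] := boolP (inside true x).
  have hx' : ~~ inside false x by move: hx; rewrite /inside; lia.
  by rewrite mirror_min_in // mirror_min_out.
have hx' : inside false x by move: hx; rewrite /inside; lia.
by rewrite mirror_min_out // mirror_min_in // addnC.
Qed.

End BlockMinima.

(** * Splitting off a pair, rotations, neighbours and crossings *)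

Section Surgery.
Variable m : nat.
Local Notation n := (2 * m)%N.
Implicit Types (r : rel 'I_n) (x y z o : 'I_n) (s e : bool).

(** The two ends o and rev_ord o of the cycle cut before o; below, o is always the
    element 0. *)
Definition ends o x := (x == o) || (x == rev_ord o).

(** If the two ends are in the same block, make them a block of their own. *)
Definition isolate o r : rel 'I_n := fun x y =>
  r x y && (r o (rev_ord o) ==> (ends o x == ends o y)).

Lemma isolate_sub o r x y : isolate o r x y -> r x y.
Proof. by case/andP. Qed.

Lemma isolate_equiv o r : is_equiv r -> is_equiv (isolate o r).
Proof.
move=> [rr sr tr]; split.
- by move=> x; rewrite /isolate rr eqxx implybT.
- by move=> x y; rewrite /isolate sr eq_sym.
- move=> y x z /andP[xy exy] /andP[yz eyz]; rewrite /isolate (tr _ _ _ xy yz).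
  by move: exy eyz; case: (r o _) => //= /eqP -> /eqP ->.
Qed.

(** The ends are neighbours of opposite parities, and removing two consecutive
    elements from a cyclically alternating block leaves an alternating one. *)
Lemma isolate_alt o r : o = 0 :> nat -> is_equiv r -> alternating r ->
  alternating (isolate o r).
Proof.
move=> o0 er ar x y; have [rr sr tr] := er.
have oro := odd_rev o; have ro0 : rev_ord o = n.-1 :> nat by rewrite rev_val o0 subn1.
have [roo|/negbTE noo] := boolP (r o (rev_ord o)); last first.
  rewrite /isolate noo /= andbT => xy /(ar _ _ xy) [z [xz oz bz]].
  by exists z; rewrite xz.
have [ex|ex] := boolP (ends o x).
  case/andP => xy; rewrite roo ex => /= ey oxy.
  have <- : x = y.
    by move: ex ey oxy => /orP[]/eqP-> /esym/eqP/orP[]/eqP-> //; rewrite odd_rev; case: (odd o).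
  exists (rev_ord x); split.
  - rewrite /isolate roo /=; apply/andP; split.
      by move: ex => /orP[]/eqP-> //; rewrite rev_ordK sr.
    by move: ex => /orP[]/eqP->; rewrite /ends ?rev_ordK ?eqxx ?orbT.
  - by rewrite odd_rev; case: (odd x).
  - have: rev_ord x != x by apply/eqP => /(congr1 (fun z : 'I_n => odd z)); rewrite odd_rev; case: (odd x).
    by rewrite /btw -val_eqE /= leqnn neq_ltn orbC => ->; rewrite orbT.
case/andP=> xy; rewrite roo (negbTE ex) => /= ey oxy.
have [z [xz oz bz]] := ar _ _ xy oxy.
have good u : r x u -> ~~ ends o u -> isolate o r x u.
  by move=> xu nu; rewrite /isolate xu roo /= (negbTE ex) (negbTE nu).
have [ez|ez] := boolP (ends o z); last by exists z; rewrite good.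
have notend (u : 'I_n) : 0 < u < n.-1 -> ~~ ends o u.
  by rewrite /ends -!val_eqE /= o0; ord_lia.
have isend (u : 'I_n) : ~~ ends o u -> 0 < u < n.-1.
  by have := ltn_ord u; rewrite /ends -!val_eqE /= o0; ord_lia.
have ny : ~~ ends o y by rewrite -(eqP ey).
have [ix iy] := (isend _ ex, isend _ ny).
have yx : y <= x.
  case/orP: bz => [h|/andP[]//]; suff: ~~ ends o z by rewrite ez.
  by apply: notend; move: h ix iy; ord_lia.
have oz' : r x o /\ r x (rev_ord o).
  case/orP: ez => /eqP zE; rewrite zE in xz; split=> //; apply: tr xz _ => //.
  by rewrite sr.
have [e|e] := eqVneq (odd x) (odd (rev_ord o)).
  have [z' [xz' oz'' bz']] := ar x (rev_ord o) oz'.2 e.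
  have : x < z' < n.-1.
    by move: bz'; rewrite /btw ro0; have := ltn_ord z'; move: ix; ord_lia.
  move=> h; exists z'; split=> //; first by apply: good => //; apply: notend; move: h ix; ord_lia.
  by move: h yx; rewrite /btw; ord_lia.
have e' : odd o = odd y by move: e; rewrite odd_rev -oxy; case: (odd x); case: (odd o).
have [|z' [oz0 oz'' bz']] := ar o y _ e'; first by apply: tr xy; rewrite sr oz'.1.
have : 0 < z' < y by move: bz' iy; rewrite /btw o0; ord_lia.
move=> h; exists z'; split; [apply: good; last by apply: notend; move: h iy; ord_lia| |].
- exact: tr oz'.1 oz0.
- by rewrite oxy -e'.
- by move: h yx; rewrite /btw; ord_lia.
Qed.

(** The new block has minimum 0, and what remains of the old one starts with an
    element of odd parity, so that no even minimum appears or disappears. *)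
Lemma nb_open_isolate o r : o = 0 :> nat -> is_equiv r -> alternating r ->
  nb_open false (isolate o r) = nb_open false r.
Proof.
move=> o0 er ar; rewrite /nb_open !addn0; apply: eq_bigr => x _; congr nat_of_bool.
have [rr sr tr] := er; have [rr' sr' tr'] := isolate_equiv o er.
have [ox|//] := boolP (odd x == false); rewrite /=.
apply/block_minP/block_minP => h y yx; last exact/h/(isolate_sub yx).
have [iyx|] := boolP (isolate o r y x); first exact: h.
rewrite /isolate yx /= negb_imply => /andP[roo ne].
rewrite leqNgt; apply/negP => lyx.
have [ex|nx] := boolP (ends o x).
  case/orP: ex => /eqP xE; first by move: lyx; rewrite xE o0.
  by move: ox; rewrite xE odd_rev o0.
move: ne; rewrite (negbTE nx) eqbF_neg negbK => /orP[] /eqP yE; last first.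
  by move: lyx; rewrite yE rev_val o0; have := ltn_ord x; ord_lia.
rewrite {}yE in yx lyx.
have [|z [oz odz bz]] := ar _ _ yx; first by rewrite (eqP ox) o0.
have bz' : 0 < z < x by move: bz lyx; rewrite /btw o0; ord_lia.
have /h : isolate o r z x.
  rewrite /isolate roo /=; apply/andP; split; first by apply: tr yx; rewrite sr.
  rewrite (negbTE nx) eqbF_neg /ends -!val_eqE /= o0.
  by have := ltn_ord x; move: bz'; ord_lia.
by rewrite leqNgt; case/andP: bz' => _ ->.
Qed.

(** Rotation of the cycle by one step; it exchanges the parities. *)
Definition rot r : rel 'I_n := fun x y => r (ordS x) (ordS y).

Lemma ordS_val x : (ordS x = x.+1 :> nat) /\ x.+1 < n \/ (ordS x = 0 :> nat) /\ x.+1 = n.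
Proof.
have := ltn_ord x; rewrite leq_eqVlt => /orP[/eqP h|h]; [right|left]; split => //=.
  by rewrite h modnn.
by rewrite modn_small.
Qed.

Lemma odd_ordS x : odd (ordS x) = ~~ odd x.
Proof.
by have [[-> _]//|[-> h]] := ordS_val x; have := congr1 odd h; rewrite /= oddM /= => ->.
Qed.

Lemma btw_ordS x y z : btw (ordS x) (ordS z) (ordS y) = btw x z y.
Proof.
have [[-> hx]|[-> hx]] := ordS_val x; have [[-> hy]|[-> hy]] := ordS_val y;
have [[-> hz]|[-> hz]] := ordS_val z; rewrite /btw; move: hx hy hz;
ord_lia.
Qed.

Lemma rot_equiv r : is_equiv r -> is_equiv (rot r).
Proof.
move=> [rr sr tr]; split=> [x|x y|y x z]; rewrite /rot //; exact: tr.
Qed.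

Lemma rot_alt r : alternating r -> alternating (rot r).
Proof.
move=> ar x y xy oxy; have [|z [xz oz bz]] := ar _ _ xy; first by rewrite !odd_ordS oxy.
exists (ord_pred z); rewrite /rot ord_predK -btw_ordS ord_predK; split=> //.
by move: oz; rewrite -{1}[z]ord_predK !odd_ordS; case: (odd x); case: (odd _).
Qed.

Lemma sum_and_pred1 (T : finType) (p : pred T) (x0 : T) :
  \sum_(x : T) (p x && (x == x0)) = p x0.
Proof.
rewrite (bigD1 x0) //= eqxx andbT big1 ?addn0 // => x /negbTE ->.
by rewrite andbF.
Qed.

(** Rotation only affects the block of 0, whose minimum becomes its second element
    u1, of the opposite parity. *)
Lemma nb_open_rot e r : 0 < m -> is_equiv r -> alternating r ->
  nb_open (~~ e) (rot r) = nb_open e r.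
Proof.
move=> m0 er ar; have [rr sr tr] := er.
have n0 : 0 < n by rewrite muln_gt0.
pose o : 'I_n := Ordinal n0.
have [u' [ou' odu' _]] := ar o o (rr o) erefl.
have u'o : u' != o by apply: contraNneq odu' => ->.
pose Q := fun u => r o u && (u != o).
have Qu' : Q u' by rewrite /Q ou'.
have [u1 /andP[ou1 u1o] minu1] := @arg_minnP _ u' Q (fun y => y : nat) Qu'.
have odu1 : odd u1.
  case ou: (odd u1) => //; have [|z [oz _ bz]] := ar o u1 ou1; first by rewrite ou.
  move: bz; rewrite /btw /= leqn0 -val_eqE /= in u1o *; rewrite (negbTE u1o) /= orbF => /andP[z0 zu].
  have := minu1 z; rewrite /Q oz -val_eqE /= -lt0n z0 => /(_ isT).
  by rewrite leqNgt zu.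
pose mn' u := [forall v : 'I_n, ((v != o) && ((u == o) || (v < u))) ==> ~~ r v u].
have mnE x : block_min (rot r) x = mn' (ordS x).
  have ltE y : (y < x) = (ordS y != o) && ((ordS x == o) || (ordS y < ordS x)).
    rewrite -!val_eqE /=.
    have [[/= -> hx]|[/= -> hx]] := ordS_val x; have [[/= -> hy]|[/= -> hy]] := ordS_val y;
    move: hx hy; ord_lia.
  apply/forallP/forallP => h y; last by rewrite ltE; apply: h.
  by rewrite -[y]ord_predK -ltE; apply: h.
(* mn' says that u is the first element of its block when 0 is moved to the end. *)
have key u : mn' u + (u == o) = block_min r u + (u == u1).
  have [->|uo] := eqVneq u o.
    rewrite eq_sym (negbTE u1o) addn0.
    have -> : block_min r o by apply/block_minP.
    suff -> : mn' o = false by [].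
    by apply/negP => /forallP/(_ u1); rewrite u1o eqxx sr ou1.
  have [->|uu] := eqVneq u u1.
    have -> : block_min r u1 = false.
      apply/negP => /block_minP/(_ o ou1); rewrite leqn0 => /eqP h.
      by case/eqP: u1o; apply/val_inj.
    rewrite addn0 add0n; suff -> : mn' u1 by [].
    apply/forallP => v; apply/implyP => /andP[vo]; rewrite (negbTE u1o) /= => vu.
    apply/negP => rvu; have := minu1 v; rewrite /Q vo (tr u1) // 1?sr // => /(_ isT).
    by rewrite leqNgt vu.
  rewrite !addn0; congr nat_of_bool; apply/forallP/block_minP => h v.
    move=> rvu; rewrite leqNgt; apply/negP => vu.
    have [vo|vo] := eqVneq v o; last by move: (h v); rewrite vo vu orbT rvu.
    move: (h u1); rewrite u1o (negbTE uo) /= (tr o) ?ou1 //; last by rewrite -vo.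
      by rewrite implybF ltn_neqAle val_eqE eq_sym uu minu1 // /Q uo -vo rvu.
    by rewrite sr.
  rewrite (negbTE uo) /=; apply/implyP => /andP[_ vu]; apply/negP => /h.
  by rewrite leqNgt vu.
rewrite /nb_open.
transitivity (\sum_(u : 'I_n) ((odd u == e) && mn' u) + ~~ e).
  congr (_ + _); rewrite [in RHS](reindex_inj (@ordS_inj n)) /=; apply: eq_bigr => x _.
  by rewrite mnE odd_ordS; case: (odd x); case: e.
have -> : ~~ e = \sum_(u : 'I_n) ((odd u == e) && (u == o)) :> nat.
  by rewrite (sum_and_pred1 (fun u : 'I_n => odd u == e)); case: e.
have -> : (e : nat) = \sum_(u : 'I_n) ((odd u == e) && (u == u1)).
  by rewrite (sum_and_pred1 (fun u : 'I_n => odd u == e)) odu1; case: e.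
rewrite -!big_split; apply: eq_bigr => u _ /=.
by case: (odd u == e) => //=; apply: key.
Qed.

Definition adjacent x y := (y == ordS x) || (x == ordS y).

(** The block of x consists of x and of one of its two neighbours on the cycle. *)
Definition good r x :=
  [exists y, adjacent x y && [forall z, r x z == (z == x) || (z == y)]].

Definition nb_good r : nat := \sum_x good r x.

Lemma goodP r x : reflect (exists2 y, adjacent x y & forall z, r x z = (z == x) || (z == y))
  (good r x).
Proof.
apply: (iffP existsP) => [[y /andP[a /forallP h]]|[y a h]]; exists y => //.
  by move=> z; apply/eqP.
by rewrite a; apply/forallP => z; rewrite h.
Qed.

Lemma adjacent_ordS x y : adjacent (ordS x) (ordS y) = adjacent x y.
Proof. by rewrite /adjacent !(inj_eq (@ordS_inj n)). Qed.

Lemma good_rot r x : good (rot r) x = good r (ordS x).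
Proof.
apply/goodP/goodP => -[y a h].
  exists (ordS y); rewrite ?adjacent_ordS // => z.
  by rewrite -[z]ord_predK -/(rot r x _) h !(inj_eq (@ordS_inj n)).
exists (ord_pred y); rewrite -1?adjacent_ordS ?ord_predK // => z.
by rewrite /rot h (inj_eq (@ordS_inj n)) -{1}[y]ord_predK (inj_eq (@ordS_inj n)).
Qed.

Lemma nb_good_rot r : nb_good (rot r) = nb_good r.
Proof.
rewrite /nb_good [RHS](reindex_inj (@ordS_inj n)) /=.
by apply: eq_bigr => x _; rewrite good_rot.
Qed.

Lemma ordS_rev x : ordS (rev_ord (ordS x)) = rev_ord x.
Proof.
apply/ord_inj; rewrite rev_val; have := ltn_ord x.
case: (ordS_val (rev_ord (ordS x))) => -[-> ];
by rewrite rev_val; case: (ordS_val x) => -[-> ]; ord_lia.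
Qed.

Lemma adjacent_rev x y : adjacent (rev_ord x) (rev_ord y) = adjacent x y.
Proof.
have key (u v : 'I_n) : (rev_ord u == ordS (rev_ord v)) = (v == ordS u).
  by rewrite -(ordS_rev u) (inj_eq (@ordS_inj n)) (inj_eq rev_ord_inj) eq_sym.
by rewrite /adjacent !key orbC.
Qed.

Lemma good_mirror_rev s r x : good (mirror s r) (rev_ord x) = good (mirror s r) x.
Proof.
suff imp u : good (mirror s r) u -> good (mirror s r) (rev_ord u).
  by apply/idP/idP => /imp //; rewrite rev_ordK.
move=> /goodP[y a h]; apply/goodP; exists (rev_ord y); first by rewrite adjacent_rev.
by move=> z; rewrite -[z]rev_ordK mirror_rev h !(inj_eq rev_ord_inj).
Qed.

(** The only neighbours in different halves are exchanged by the reflection. *)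
Lemma adjacent_out s x y : inside s x -> ~~ inside s y -> adjacent x y ->
  y = rev_ord x.
Proof.
move=> hx hy a; apply/val_inj; move: hx hy a; rewrite /inside /adjacent -!val_eqE /=.
have [[/= -> hx]|[/= -> hx]] := ordS_val x; have [[/= -> hy]|[/= -> hy]] := ordS_val y;
move: hx hy; case: s => /=; ord_lia.
Qed.

Lemma good_mirror s r x : is_equiv r -> inside s x -> good r x -> good (mirror s r) x.
Proof.
move=> er hx /goodP[y a h]; apply/goodP; exists y => // z.
have [hz|hz] := boolP (inside s z); first by rewrite mirror_in.
rewrite mirror_in_out //.
have zx : (z == x) = false by apply: contraNF hz => /eqP ->.
have [hy|hy] := boolP (inside s y).
  have zy : (z == y) = false by apply: contraNF hz => /eqP ->.
  rewrite zx zy /=; apply/negbTE; rewrite negb_and; apply/orP; right.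
  apply/crossesP => -[u]; rewrite h => /orP[]/eqP ->; first by rewrite hx.
  by rewrite hy.
have yE := adjacent_out hx hy a.
have -> : crosses s r x by apply/crossesP; exists y => //; rewrite h eqxx orbT.
rewrite andbT h yE (inj_eq rev_ord_inj) zx orbF /=.
by rewrite -(inj_eq rev_ord_inj) rev_ordK.
Qed.

(** The good elements of the half s. *)
Definition nb_good_in s r := \sum_(x | inside s x) good r x.

Lemma nb_good_mirror s r :
  nb_good (mirror s r) = 2 * nb_good_in s (mirror s r).
Proof.
rewrite /nb_good (bigID (inside s)) /= [RHS]mul2n -[RHS]addnn; congr (_ + _).
rewrite [LHS](reindex_inj rev_ord_inj) /=; apply: eq_big => x; last by rewrite good_mirror_rev.
by rewrite inside_rev negbK.
Qed.

Lemma nb_good_split r : nb_good r = nb_good_in true r + nb_good_in false r.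
Proof.
rewrite /nb_good (bigID (inside true)) /=; congr (_ + _).
by apply: eq_bigl => x; rewrite /inside -leqNgt.
Qed.

Lemma nb_good_in_le s r : is_equiv r -> nb_good_in s r <= nb_good_in s (mirror s r).
Proof.
move=> er; apply: leq_sum => x hx; have := @good_mirror s r x er hx.
by case: (good r x) => // ->.
Qed.

Lemma nb_good_mirror_le r : is_equiv r ->
  2 * nb_good r <= nb_good (mirror true r) + nb_good (mirror false r).
Proof.
move=> er; rewrite !nb_good_mirror nb_good_split -mulnDr leq_mul2l /=.
by apply: leq_add; apply: nb_good_in_le.
Qed.

Lemma nb_good_mirror_lt s r x : is_equiv r -> inside s x -> ~~ good r x ->
  good (mirror s r) x ->
  2 * nb_good r < nb_good (mirror true r) + nb_good (mirror false r).
Proof.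
move=> er hx gx gx'; rewrite !nb_good_mirror nb_good_split -mulnDr ltn_pmul2l //.
have lt : nb_good_in s r < nb_good_in s (mirror s r).
  rewrite /nb_good_in (bigD1 x) //= (negbTE gx) [X in _ < X](bigD1 x) //= gx' ltnS.
  apply: leq_sum => y /andP[hy _]; have := @good_mirror s r y er hy.
  by case: (good r y) => // ->.
have := nb_good_in_le true er; have := nb_good_in_le false er.
by case: s lt {hx gx'} => lt h1 h2; [rewrite -addSn|rewrite -addnS]; apply: leq_add.
Qed.

Lemma isolateE o r x y : ~~ r o (rev_ord o) -> isolate o r x y = r x y.
Proof. by move=> h; rewrite /isolate (negbTE h) andbT. Qed.

Lemma ordS_last o : o = 0 :> nat -> ordS (rev_ord o) = o.
Proof.
move=> o0; apply/ord_inj; case: (ordS_val (rev_ord o)) => -[-> ].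
  by rewrite rev_val o0; have := ltn_ord o; ord_lia.
by rewrite o0.
Qed.

Lemma adjacent_ends o x : o = 0 :> nat -> ends o x -> adjacent x (rev_ord x).
Proof.
by move=> o0 /orP[] /eqP ->; rewrite /adjacent ?rev_ordK ordS_last ?eqxx ?orbT.
Qed.

Lemma ends_rev o x : ends o (rev_ord x) = ends o x.
Proof. by rewrite /ends (inj_eq rev_ord_inj) -{1}[o]rev_ordK (inj_eq rev_ord_inj) orbC. Qed.

Lemma ends_cases o x z : ends o x -> ends o z = (z == x) || (z == rev_ord x).
Proof. by move=> /orP[] /eqP ->; rewrite /ends ?rev_ordK // orbC. Qed.

Lemma good_isolate_ends o r x : o = 0 :> nat -> is_equiv r -> r o (rev_ord o) ->
  ends o x -> good (isolate o r) x.
Proof.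
move=> o0 [rr sr tr] roo ex; apply/goodP; exists (rev_ord x); first exact: adjacent_ends ex.
move=> z; rewrite /isolate roo ex /= -(ends_cases _ ex).
case ez: (ends o z); rewrite ?andbF // andbT.
by move: ex ez => /orP[] /eqP -> /orP[] /eqP ->; rewrite ?rr // sr.
Qed.

Lemma rev_neq x : rev_ord x != x.
Proof. by apply/eqP => /(congr1 (fun z : 'I_n => odd z)); rewrite odd_rev; case: (odd x). Qed.

Lemma good_isolate o r x : o = 0 :> nat -> is_equiv r ->
  good r x -> good (isolate o r) x.
Proof.
move=> o0 er gx; have [rr sr tr] := er.
have [roo|noo] := boolP (r o (rev_ord o)); last first.
  by case/goodP: gx => y a h; apply/goodP; exists y => // z; rewrite isolateE.
have [ex|ex] := boolP (ends o x); first exact: good_isolate_ends.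
case/goodP: gx => y a h; apply/goodP; exists y => // z; rewrite -h /isolate.
have [xz|//] := boolP (r x z); rewrite roo (negbTE ex) /= eq_sym eqbF_neg.
apply/negP => ez.
have [xo xo'] : r x o /\ r x (rev_ord o).
  by case/orP: ez => /eqP zE; rewrite zE in xz; split=> //; apply: tr xz _ => //; rewrite sr.
move: xo xo' ex; rewrite !h /ends negb_or => /orP[/eqP->|/eqP oy]; first by rewrite eqxx.
case/orP=> [/eqP->|]; first by rewrite eqxx andbF.
by rewrite -oy (negbTE (rev_neq o)).
Qed.

Lemma nb_good_isolate o r : o = 0 :> nat -> is_equiv r -> nb_good r <= nb_good (isolate o r).
Proof.
move=> o0 er; apply: leq_sum => x _; have := @good_isolate o r x o0 er.
by case: (good r x) => // ->.
Qed.

(** If 0 is not good and its block leaves the lower half, then symmetrizing and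
    splitting off the ends makes 0 good. *)
Lemma gain_isolate o r : o = 0 :> nat -> is_equiv r -> ~~ good r o -> crosses true r o ->
  2 * nb_good r < nb_good (isolate o (mirror true r)) + nb_good (mirror false r).
Proof.
move=> o0 er go co; have er' := mirror_equiv true er.
have ino : inside true o by rewrite /inside o0; have := ltn_ord o; rewrite o0; ord_lia.
have [g|g] := boolP (good (mirror true r) o).
  apply: leq_trans (nb_good_mirror_lt er ino go g) _.
  by rewrite leq_add2r nb_good_isolate.
apply: leq_ltn_trans (nb_good_mirror_le er) _; rewrite ltn_add2r.
have g' : good (isolate o (mirror true r)) o.
  by apply: good_isolate_ends => //; rewrite ?mirror_self // /ends eqxx.
rewrite /nb_good (bigD1 o) //= (negbTE g) [X in _ < X](bigD1 o) //= g' ltnS.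
apply: leq_sum => x _; have := @good_isolate o _ x o0 er'.
by case: (good (mirror true r) x) => // ->.
Qed.

(** If the last element is alone in the upper half within its block, then
    symmetrizing along the upper half pairs it with 0. *)
Lemma gain_last o r z : o = 0 :> nat -> is_equiv r -> ~~ good r (rev_ord o) ->
  (forall x, r (rev_ord o) x -> m <= x -> x = rev_ord o) -> r (rev_ord o) z -> z < m ->
  2 * nb_good r < nb_good (mirror true r) + nb_good (mirror false r).
Proof.
move=> o0 er go only oz zm; have [rr sr tr] := er.
have inl : inside false (rev_ord o).
  by rewrite /inside rev_val o0; have := ltn_ord o; rewrite o0; ord_lia.
apply: (nb_good_mirror_lt er inl go); apply/goodP; exists o.
  by rewrite /adjacent ordS_last ?eqxx // ?orbT.
have oE x : inside false x -> r (rev_ord o) x = (x == rev_ord o).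
  by move=> hx; apply/idP/eqP => [/only|->]; rewrite ?rr // => /(_ hx).
move=> x; have [hx|hx] := boolP (inside false x).
  rewrite mirror_in // oE //; case: (x =P o) => [xo|_]; last by rewrite orbF.
  by move: hx; rewrite xo -[o]rev_ordK inside_rev inl.
rewrite mirror_in_out // oE ?inside_rev // (inj_eq rev_ord_inj).
have -> : crosses false r (rev_ord o) by apply/crossesP; exists z; rewrite // /inside -ltnNge.
rewrite andbT; case: (x =P rev_ord o) => [xo|_ //].
by move: hx; rewrite xo inl.
Qed.

(** For two labels i < j, after e y x says that the point of label j in the interval
    y comes after the point of label i in the interval x: inside an interval labels
    increase when its parity is e and decrease otherwise. *)
Definition after e y x := (x < y) || ((x == y) && (odd y == e)).

(** No chord of r2 crosses a chord of r1, for a label of r1 smaller than that of r2: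
    the exclusive or of the four comparisons tells whether {x, x'} separates
    {y, y'}. *)
Definition uncrossed e r1 r2 : Prop := forall x x' y y', r1 x x' -> r2 y y' ->
  after e y x (+) after e y x' (+) (after e y' x (+) after e y' x') = false.

Lemma uncrossed_sub e (r1 r2 t1 t2 : rel 'I_n) : subrel t1 r1 -> subrel t2 r2 ->
  uncrossed e r1 r2 -> uncrossed e t1 t2.
Proof. by move=> s1 s2 u x x' y y' /s1 h1 /s2 h2; apply: u. Qed.

Lemma after_rev e x y : after e (rev_ord y) (rev_ord x) = ~~ after e y x.
Proof.
rewrite /after rev_lt (inj_eq rev_ord_inj) odd_rev.
case: (ltngtP x y) => //= [h|h|/ord_inj ->].
- by apply/negbTE; rewrite negb_and -val_eqE /= neq_ltn h.
- by rewrite negb_and -val_eqE /= neq_ltn h orbT.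
- by rewrite eqxx /=; case: (odd y); case: e.
Qed.

Lemma after_side e s x y : inside s x -> ~~ inside s y ->
  after e y x = s /\ after e x y = ~~ s.
Proof.
move=> hx hy; have xy : x != y by apply: contraTneq hx => ->.
rewrite /after [y == x]eq_sym !(negbTE xy) !orbF (lt_side hx hy); split=> //.
by rewrite -(lt_side hx hy) -leqNgt ltn_neqAle (inj_eq (@ord_inj n)) eq_sym xy.
Qed.

Lemma uncrossed_mirror e s r1 r2 : is_equiv r1 -> is_equiv r2 ->
  uncrossed e r1 r2 -> uncrossed e (mirror s r1) (mirror s r2).
Proof.
move=> e1 e2 u; have [rr1 sr1 tr1] := e1; have [rr2 sr2 tr2] := e2.
have [_ sm1 _] := mirror_equiv s e1; have [_ sm2 _] := mirror_equiv s e2.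
pose G x x' y y' := after e y x (+) after e y x' (+) (after e y' x (+) after e y' x').
have swap1 x x' y y' : G x' x y y' = G x x' y y'.
  by rewrite /G; do 4!case: after.
have swap2 x x' y y' : G x x' y' y = G x x' y y'.
  by rewrite /G; do 4!case: after.
have Grev x x' y y' : G (rev_ord x) (rev_ord x') (rev_ord y) (rev_ord y') = G x x' y y'.
  by rewrite /G !after_rev; do 4!case: after.
have in_in x x' y y' : mirror s r1 x x' -> mirror s r2 y y' ->
    inside s x -> inside s y -> G x x' y y' = false.
  move=> xx yy hx hy.
  have [hx'|hx'] := boolP (inside s x'); have [hy'|hy'] := boolP (inside s y').
  - by apply: u; rewrite -(@mirror_in _ s).
  - move: xx yy; rewrite mirror_in // mirror_in_out // => xx /andP[_ /crossesP[w yw hw]].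
    have := u _ _ _ _ xx yw; rewrite /G.
    rewrite (after_side e hx hw).1 (after_side e hx hy').1.
    by rewrite (after_side e hx' hw).1 (after_side e hx' hy').1.
  - move: xx yy; rewrite mirror_in_out // mirror_in // => /andP[_ /crossesP[w xw hw]] yy.
    have := u _ _ _ _ xw yy; rewrite /G.
    rewrite (after_side e hy hw).2 (after_side e hy hx').2.
    by rewrite (after_side e hy' hw).2 (after_side e hy' hx').2.
  - move: xx yy; rewrite !mirror_in_out // => /andP[xx /crossesP[z xz hz]].
    move=> /andP[yy /crossesP[w yw hw]].
    have hrx : inside s (rev_ord x') by rewrite inside_rev.
    have hry : inside s (rev_ord y') by rewrite inside_rev.
    have xz' : r1 (rev_ord x') z by apply: tr1 xz; rewrite sr1.
    have := u _ _ _ _ xx yw; have := u _ _ _ _ xz' yy; rewrite /G.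
    have -> : after e y' x' = ~~ after e (rev_ord y') (rev_ord x') by rewrite after_rev negbK.
    rewrite (after_side e hx hw).1 (after_side e hrx hw).1.
    rewrite (after_side e hy hz).2 (after_side e hry hz).2.
    rewrite (after_side e hy hx').2 (after_side e hx hy').1.
    by case: (after e y x); case: (after e y _); case: (after e _ _); case: (s).
have out_out x x' y y' : mirror s r1 x x' -> mirror s r2 y y' ->
    ~~ inside s x -> ~~ inside s y -> G x x' y y' = false.
  by move=> xx yy hx hy; rewrite -Grev; apply: in_in; rewrite ?mirror_rev ?inside_rev.
move=> x x' y y' xx yy; rewrite -/(G x x' y y').
have xx' : mirror s r1 x' x by rewrite sm1.
have yy' : mirror s r2 y' y by rewrite sm2.
have [hx|hx] := boolP (inside s x); have [hy|hy] := boolP (inside s y);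
  [exact: in_in| | |exact: out_out].
- have [hx'|hx'] := boolP (inside s x'); last by rewrite -swap1; apply: out_out.
  have [hy'|hy'] := boolP (inside s y'); first by rewrite -swap2; apply: in_in.
  rewrite /G (after_side e hx hy).1 (after_side e hx' hy).1.
  by rewrite (after_side e hx hy').1 (after_side e hx' hy').1; case: (s).
- have [hx'|hx'] := boolP (inside s x'); first by rewrite -swap1; apply: in_in.
  have [hy'|hy'] := boolP (inside s y'); last by rewrite -swap2; apply: out_out.
  rewrite /G (after_side e hy hx).2 (after_side e hy hx').2.
  by rewrite (after_side e hy' hx).2 (after_side e hy' hx').2; case: (s).
Qed.

Lemma after_rot e x y :
  after (~~ e) y x = after e (ordS y) (ordS x) (+) (ordS x == 0 :> nat) (+) (ordS y == 0 :> nat).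
Proof.
rewrite /after odd_ordS (inj_eq (@ordS_inj n)) -!val_eqE /=.
have -> : (odd y == ~~ e) = (~~ odd y == e) by case: (odd y); case: e.
have [[/= -> hx]|[/= -> hx]] := ordS_val x; have [[/= -> hy]|[/= -> hy]] := ordS_val y;
move: hx hy; case: (~~ odd y == e); ord_lia.
Qed.

Lemma uncrossed_rot e r1 r2 : uncrossed e r1 r2 -> uncrossed (~~ e) (rot r1) (rot r2).
Proof.
move=> u x x' y y' xx yy; have := u _ _ _ _ xx yy; rewrite !after_rot.
by do 4!case: (after e _ _); do 4!case: (_ == _ :> nat).
Qed.

End Surgery.

(** * Sums of traces of words *)

Section Algebra.
Local Open Scope ring_scope.
Local Open Scope sesquilinear_scope.
Variable C : numClosedFieldType.

(** Cauchy-Schwarz, transported from row vectors to families indexed by a finite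
    type. *)
Lemma cauchy_schwarz_dot (I : finType) (u v : I -> C) :
  `|\sum_i u i * (v i)^*| ^+ 2 <= (\sum_i u i * (u i)^*) * (\sum_i v i * (v i)^*).
Proof.
pose w (f : I -> C) : 'rV[C]_#|I| := \row_i f (enum_val i).
have wE f g : dotmx (w f) (w g) = \sum_i f i * (g i)^*.
  rewrite dotmxE !mxE [RHS](reindex_onto enum_val enum_rank) /=; last first.
    by move=> i _; rewrite enum_rankK.
  by apply: eq_big => [i|i _]; rewrite ?enum_valK ?eqxx // !mxE.
by rewrite -!wE; apply: (CauchySchwarz (@dotmx C _)).
Qed.

Lemma mxtrace_mul_adj k (X Y : 'M[C]_k) :
  \tr (X *m Y ^t*) = \sum_(p : 'I_k * 'I_k) X p.1 p.2 * (Y p.1 p.2)^*.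
Proof.
rewrite /mxtrace -(pair_bigA _ (fun i j => X i j * (Y i j)^*)) /=.
apply: eq_bigr => i _; rewrite mxE; apply: eq_bigr => j _.
by rewrite !mxE.
Qed.

Lemma mxtrace_mul_adj_ge0 k (X : 'M[C]_k) : 0 <= \tr (X *m X ^t*).
Proof. by rewrite mxtrace_mul_adj; apply: sumr_ge0 => p _; rewrite mul_conjC_ge0. Qed.

Lemma mxtrace_mul_adj_eq0 k (X : 'M[C]_k) : \tr (X *m X ^t*) = 0 -> X = 0.
Proof.
rewrite mxtrace_mul_adj => /eqP; rewrite psumr_eq0 => [/allP h|p _]; last exact: mul_conjC_ge0.
apply/matrixP => i j; have := h (i, j); rewrite mem_index_enum mul_conjC_eq0 mxE.
by move=> /(_ isT)/eqP.
Qed.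

Lemma cauchy_schwarz_tr (I : finType) k (X Y : I -> 'M[C]_k) :
  `|\sum_i \tr (X i *m (Y i) ^t*)| ^+ 2 <=
  (\sum_i \tr (X i *m (X i) ^t*)) * (\sum_i \tr (Y i *m (Y i) ^t*)).
Proof.
have E (Z W : I -> 'M[C]_k) : \sum_i \tr (Z i *m (W i) ^t*) =
    \sum_(q : I * ('I_k * 'I_k)) Z q.1 q.2.1 q.2.2 * (W q.1 q.2.1 q.2.2)^*.
  rewrite -(pair_bigA _ (fun i p => Z i p.1 p.2 * (W i p.1 p.2)^*)) /=.
  by apply: eq_bigr => i _; rewrite mxtrace_mul_adj.
by rewrite !E; apply: cauchy_schwarz_dot.
Qed.

Lemma adjM i j k (X : 'M[C]_(i, j)) (Y : 'M[C]_(j, k)) : (X *m Y) ^t* = Y ^t* *m X ^t*.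
Proof. by rewrite trmx_mul map_mxM. Qed.

Lemma adj_sum (I : Type) (s : seq I) (p : pred I) i j (X : I -> 'M[C]_(i, j)) :
  (\sum_(x <- s | p x) X x) ^t* = \sum_(x <- s | p x) (X x) ^t*.
Proof. by rewrite raddf_sum /= map_mx_sum. Qed.

Lemma adj_prod k n (X : 'I_n -> 'M[C]_k) :
  (\prod_(i < n) X i) ^t* = \prod_(i < n) (X (rev_ord i)) ^t*.
Proof.
elim: n X => [|n IHn] X; first by rewrite !big_ord0 trmx1 map_mx1.
rewrite big_ord_recl big_ord_recr /= -[_ * _]/(_ *m _) adjM IHn.
rewrite -[RHS]/(_ *m _); congr (_ *m _).
  apply: eq_bigr => i _; congr ((X _) ^t*); apply/val_inj; rewrite /= /bump.
  by have := ltn_ord i; lia.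
by congr ((X _) ^t*); apply/val_inj; rewrite /= subnn.
Qed.

Lemma mxtrace_prod_ordS k n (X : 'I_n -> 'M[C]_k) :
  \tr (\prod_(i < n) X (ordS i)) = \tr (\prod_(i < n) X i).
Proof.
case: n X => [|n] X; first by rewrite !big_ord0.
rewrite big_ord_recr [in RHS]big_ord_recl /= -[_ * _]/(_ *m _) mxtrace_mulC.
congr (\tr (_ *m _)); first by congr (X _); apply/val_inj; rewrite /= modnn.
apply: eq_bigr => i _; congr (X _); apply/val_inj => /=.
by rewrite /bump /= add1n modn_small ?ltnS ?ltn_ord.
Qed.

End Algebra.

Section Sums.
Local Open Scope ring_scope.
Local Open Scope sesquilinear_scope.
Variables (C : numClosedFieldType) (m d alpha : nat) (U : finType).
Local Notation n := (2 * m)%N.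
Notation V := {ffun 'I_d -> U}.
Variable a : V -> 'M[C]_alpha.
Implicit Types (E : 'I_d -> rel 'I_n) (e : bool).

(** The matrices of a word: a_v, or its adjoint when e is true. *)
Definition letter e (v : V) : 'M[C]_alpha := if e then (a v) ^t* else a v.

(** The words of indices k with k x i = k y i whenever E i relates x and y. *)
Definition compatible E (k : {ffun 'I_n -> V}) :=
  [forall i, forall x, forall y, E i x y ==> (k x i == k y i)].

Definition word e (k : {ffun 'I_n -> V}) := \prod_(x < n) letter (odd x (+) e) (k x).

(** The sum S attached to the family E; e is the parity of the positions without
    adjoint. *)
Definition wordsum e E := \sum_(k | compatible E k) \tr (word e k).

Lemma compatibleP E (k : {ffun 'I_n -> V}) : reflect (forall i x y, E i x y -> k x i = k y i) (compatible E k).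
Proof.
apply: (iffP forallP) => [h i x y xy|h i].
  by have /forallP/(_ x)/forallP/(_ y) := h i; rewrite xy => /eqP.
by apply/forallP => x; apply/forallP => y; apply/implyP => /h ->.
Qed.

Lemma letter_adj e v : (letter e v) ^t* = letter (~~ e) v.
Proof. by case: e; rewrite /letter //= trmxCK. Qed.

Lemma wordsum_rot e E : wordsum (~~ e) (fun i => rot (E i)) = wordsum e E.
Proof.
pose h (k : {ffun 'I_n -> V}) := [ffun x => k (ordS x)].
pose g (k : {ffun 'I_n -> V}) := [ffun x => k (ord_pred x)].
have hg : cancel h g by move=> k; apply/ffunP => x; rewrite !ffunE ord_predK.
have gh : cancel g h by move=> k; apply/ffunP => x; rewrite !ffunE ordSK.
rewrite /wordsum (reindex_inj (can_inj hg)) /=; apply: eq_big => k.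
  apply/compatibleP/compatibleP => H i x y xy; last by rewrite !ffunE; apply: H.
  by have := H i (ord_pred x) (ord_pred y); rewrite /rot !ffunE !ord_predK; apply.
move=> _; rewrite -[RHS]mxtrace_prod_ordS; congr (\tr _); apply: eq_bigr => x _.
by rewrite ffunE odd_ordS; congr (letter _ _); case: (odd x); case: e.
Qed.

Notation half := {ffun 'I_m -> V}.

Lemma lo_subproof : (m <= n)%N. Proof. by rewrite leq_pmull. Qed.
(** The j-th element of the lower half, and its mirror image. *)
Definition lo (j : 'I_m) : 'I_n := widen_ord lo_subproof j.
Definition hi (j : 'I_m) : 'I_n := rev_ord (lo j).

Lemma inside_lo j : inside true (lo j). Proof. by rewrite /inside /= ltn_ord. Qed.
Lemma inside_hi j : inside false (hi j).
Proof. by rewrite /inside /=; have := ltn_ord j; ord_lia. Qed.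
Lemma outside_lo j : ~~ inside false (lo j). Proof. by rewrite /inside /= -ltnNge ltn_ord. Qed.
Lemma outside_hi j : ~~ inside true (hi j). Proof. by rewrite inside_rev inside_lo. Qed.

Lemma fold_half_subproof (x : 'I_n) : (pull true x < m)%N.
Proof. exact: (inside_pull true x). Qed.
Definition fold_half (x : 'I_n) : 'I_m := Ordinal (fold_half_subproof x).

Lemma lo_fold_half (x : 'I_n) : inside true x -> lo (fold_half x) = x.
Proof. by move=> hx; apply/val_inj; rewrite /= pull_in. Qed.

Lemma hi_fold_half (x : 'I_n) : ~~ inside true x -> hi (fold_half x) = x.
Proof.
by move=> hx; rewrite /hi -[RHS]rev_ordK; congr rev_ord; apply/val_inj; rewrite /= pull_out.
Qed.

Lemma fold_half_lo j : fold_half (lo j) = j.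
Proof. by apply/val_inj; rewrite /= pull_in ?inside_lo. Qed.

Lemma fold_half_hi j : fold_half (hi j) = j.
Proof. by apply/val_inj; rewrite /= pull_out ?outside_hi // /hi rev_ordK. Qed.

(** A word of length 2m made of h and of g read backwards from the end. *)
Definition glue (h g : half) : {ffun 'I_n -> V} :=
  [ffun x => if inside true x then h (fold_half x) else g (fold_half x)].

Lemma glue_lo h g j : glue h g (lo j) = h j.
Proof. by rewrite ffunE inside_lo fold_half_lo. Qed.

Lemma glue_hi h g j : glue h g (hi j) = g j.
Proof. by rewrite ffunE (negbTE (outside_hi j)) fold_half_hi. Qed.

Definition halfword e (h : half) : 'M[C]_alpha := \prod_(j < m) letter (odd j (+) e) (h j).

Lemma prod_halves k (X : 'I_n -> 'M[C]_k) :
  \prod_(x < n) X x = (\prod_(j < m) X (lo j)) *m (\prod_(j < m) X (hi (rev_ord j))).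
Proof.
have H (p : nat) (e : p = (m + m)%N) (Y : 'I_p -> 'M[C]_k) : \prod_(x < p) Y x =
    (\prod_(j < m) Y (cast_ord (esym e) (lshift m j))) *m
    (\prod_(j < m) Y (cast_ord (esym e) (rshift m j))).
  subst p; rewrite big_split_ord; congr (_ *m _);
  by apply: eq_bigr => i _; rewrite cast_ord_id.
have e : (n = m + m)%N by rewrite mul2n addnn.
rewrite (H _ e); congr (_ *m _); apply: eq_bigr => j _; congr (X _); apply/val_inj => //=.
by have := ltn_ord j; ord_lia.
Qed.

(** Reading backwards and the change of parity under reflection combine into an
    adjoint. *)
Lemma word_glue e h g : word e (glue h g) = halfword e h *m (halfword e g) ^t*.
Proof.
rewrite /word prod_halves /halfword adj_prod; congr (_ *m _).
  by apply: eq_bigr => j _; rewrite glue_lo.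
apply: eq_bigr => j _; rewrite glue_hi letter_adj; congr (letter _ _).
by rewrite odd_rev; case: e => /=; rewrite ?addbT ?addbF ?negbK.
Qed.

Lemma wordsum_halves e E : wordsum e E =
  \sum_h \sum_(g | compatible E (glue h g)) \tr (halfword e h *m (halfword e g) ^t*).
Proof.
rewrite pair_big_dep /= /wordsum.
pose f (p : half * half) := glue p.1 p.2.
pose f' (k : {ffun 'I_n -> V}) : half * half := ([ffun j => k (lo j)], [ffun j => k (hi j)]).
rewrite (reindex f) /=; last first.
  exists f' => [[h g] _|k _].
    by congr pair; apply/ffunP => j; rewrite ffunE /= ?glue_lo ?glue_hi.
  apply/ffunP => x; rewrite ffunE /=.
  by case: ifP => [hx|/negbT hx]; rewrite ffunE ?lo_fold_half ?hi_fold_half.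
by apply: eq_bigr => -[h g] _; rewrite word_glue.
Qed.

Lemma compatible_glue E h g : (forall i, symmetric (E i)) ->
  compatible E (glue h g) <->
  [/\ forall i j j', E i (lo j) (lo j') -> h j i = h j' i,
      forall i j j', E i (hi j) (hi j') -> g j i = g j' i
    & forall i j j', E i (lo j) (hi j') -> h j i = g j' i].
Proof.
move=> sE; split=> [/compatibleP H|[H1 H2 H3]].
  split=> i j j' /H; rewrite ?glue_lo ?glue_hi //.
apply/compatibleP => i x y xy; rewrite !ffunE.
have [hx|hx] := boolP (inside true x); have [hy|hy] := boolP (inside true y).
- by apply: H1; rewrite !lo_fold_half.
- by apply: H3; rewrite lo_fold_half // hi_fold_half.
- by apply/esym/H3; rewrite lo_fold_half // hi_fold_half // sE.
- by apply: H2; rewrite !hi_fold_half.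
Qed.

Section Keys.
Local Open Scope ring_scope.
Local Open Scope sesquilinear_scope.
Variables (K : finType) (e : bool).
Implicit Types (c : pred half) (kap : half -> K).

(** The sum of the half-words satisfying c that have the boundary data t. *)
Definition slice c kap t : 'M[C]_alpha := \sum_(h | c h && (kap h == t)) halfword e h.

Lemma wordsum_slices E c1 c2 kap1 kap2 :
  (forall h g, compatible E (glue h g) = [&& c1 h, c2 g & kap1 h == kap2 g]) ->
  wordsum e E = \sum_t \tr (slice c1 kap1 t *m (slice c2 kap2 t) ^t*).
Proof.
move=> H; rewrite wordsum_halves.
pose f h g := \tr (halfword e h *m (halfword e g) ^t*).
transitivity (\sum_(h | c1 h) \sum_(g | c2 g && (kap1 h == kap2 g)) f h g).
  rewrite [RHS]big_mkcond; apply: eq_bigr => h _.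
  case: ifP => ch; first by apply: eq_bigl => g; rewrite H ch.
  by rewrite big_pred0 // => g; rewrite H ch.
rewrite (partition_big kap1 predT) //=; apply: eq_bigr => t _.
rewrite /slice adj_sum mulmx_suml raddf_sum /=; apply: eq_bigr => h /andP[_ /eqP ht].
rewrite mulmx_sumr raddf_sum /=; apply: eq_bigl => g.
by rewrite ht [t == _]eq_sym.
Qed.

End Keys.

Implicit Types h g : half.

(** Compatibility of a half-word with relations internal to one half. *)
Definition inner (r : 'I_d -> rel 'I_m) : pred half := fun h =>
  [forall i, forall j, forall j', r i j j' ==> (h j i == h j' i)].

Lemma innerP (r : 'I_d -> rel 'I_m) (h : half) :
  reflect (forall i j j', r i j j' -> h j i = h j' i) (inner r h).
Proof.
apply: (iffP forallP) => [H i x y xy|H i].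
  by have /forallP/(_ x)/forallP/(_ y) := H i; rewrite xy => /eqP.
by apply/forallP => x; apply/forallP => y; apply/implyP => /H ->.
Qed.

Definition low E i : rel 'I_m := fun j j' => E i (lo j) (lo j').
Definition high E i : rel 'I_m := fun j j' => E i (hi j) (hi j').

(** An element of the upper half in the block of lo j, if that block crosses the
    cut. *)
Definition partner E i j := [pick j' | E i (lo j) (hi j')].

(** The values taken by a half-word on the blocks that cross the cut, read at their
    elements in the lower half (keylo) or at the chosen elements in the upper half
    (keyhi). *)
Definition keylo E (h : half) : {ffun 'I_d * 'I_m -> option U} :=
  [ffun p => omap (fun=> h p.2 p.1) (partner E p.1 p.2)].
Definition keyhi E (g : half) : {ffun 'I_d * 'I_m -> option U} :=
  [ffun p => omap (fun j' => g j' p.1) (partner E p.1 p.2)].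

Lemma crosses_lo (r : rel 'I_n) j : reflect (exists j', r (lo j) (hi j')) (crosses true r (lo j)).
Proof.
apply: (iffP (crossesP _ _ _)) => [[z xz hz]|[j' h]].
  by exists (fold_half z); rewrite hi_fold_half.
by exists (hi j') => //; apply: outside_hi.
Qed.

Lemma crosses_hi (r : rel 'I_n) j : reflect (exists j', r (hi j) (lo j')) (crosses false r (hi j)).
Proof.
apply: (iffP (crossesP _ _ _)) => [[z xz hz]|[j' h]].
  by exists (fold_half z); rewrite lo_fold_half //; move: hz; rewrite /inside -ltnNge.
by exists (lo j') => //; apply: outside_lo.
Qed.

Section Equiv.
Local Open Scope ring_scope.
Local Open Scope sesquilinear_scope.
Variable E : 'I_d -> rel 'I_n.
Hypothesis eE : forall i, is_equiv (E i).

Let rE i x : E i x x. Proof. by have [h _ _] := eE i. Qed.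
Let sE i : symmetric (E i). Proof. by have [_ h _] := eE i. Qed.
Let tE i : transitive (E i). Proof. by have [_ _ h] := eE i. Qed.

Lemma keylo_keyhi h g : inner (high E) g ->
  reflect (forall i j j', E i (lo j) (hi j') -> h j i = g j' i) (keylo E h == keyhi E g).
Proof.
move/innerP => gi; apply: (iffP eqP) => [H i j j' jj'|H].
  have /ffunP/(_ (i, j)) := H; rewrite !ffunE /= /partner.
  case: pickP => [j1 jj1 /= [->]|/(_ j')]; last by rewrite jj'.
  by apply: gi; apply: tE jj'; rewrite sE.
apply/ffunP => -[i j]; rewrite !ffunE /= /partner; case: pickP => //= j' jj'.
by rewrite (H i j j').
Qed.

Lemma keylo_keylo h g :
  reflect (forall i j, crosses true (E i) (lo j) -> h j i = g j i) (keylo E h == keylo E g).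
Proof.
apply: (iffP eqP) => [H i j /crosses_lo [j' jj']|H].
  have /ffunP/(_ (i, j)) := H; rewrite !ffunE /= /partner.
  by case: pickP => [j1 jj1 /= [->]|/(_ j')] //; rewrite jj'.
apply/ffunP => -[i j]; rewrite !ffunE /= /partner; case: pickP => //= j' jj'.
by rewrite (H i j) //; apply/crosses_lo; exists j'.
Qed.

Lemma keyhi_keyhi h g : inner (high E) h -> inner (high E) g ->
  reflect (forall i j, crosses false (E i) (hi j) -> h j i = g j i) (keyhi E h == keyhi E g).
Proof.
move=> /innerP hh /innerP hg; apply: (iffP eqP) => [H i j /crosses_hi [j' jj']|H].
  have /ffunP/(_ (i, j')) := H; rewrite !ffunE /= /partner.
  case: pickP => [j1 jj1 /= [e]|/(_ j)]; last by rewrite sE jj'.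
  have j1j : high E i j1 j by rewrite /high sE; apply: tE jj1.
  by rewrite -(hh _ _ _ j1j) e; apply: hg.
apply/ffunP => -[i j]; rewrite !ffunE /= /partner; case: pickP => //= j' jj'.
by rewrite (H i j') //; apply/crosses_hi; exists j; rewrite sE.
Qed.

(** Compatibility splits into a condition on each half-word and the equality of their
    values on the crossing blocks. *)
Lemma compatible_halves h g : compatible E (glue h g) =
  [&& inner (low E) h, inner (high E) g & keylo E h == keyhi E g].
Proof.
apply/idP/and3P => [/(compatible_glue _ _ sE) [H1 H2 H3]|[/innerP H1 gi H3]].
  have gi : inner (high E) g by apply/innerP.
  by split=> //; [apply/innerP|apply/keylo_keyhi].
apply/(compatible_glue _ _ sE); split=> //; first exact/innerP.
exact/keylo_keyhi.
Qed.

Let M s i := mirror s (E i).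

Let sM s i : symmetric (M s i).
Proof. by have [_ h _] := mirror_equiv s (eE i). Qed.

Lemma compatible_mirror_true h g : compatible (M true) (glue h g) =
  [&& inner (low E) h, inner (low E) g & keylo E h == keylo E g].
Proof.
have lowE i j j' : M true i (lo j) (lo j') = low E i j j'.
  by rewrite /M mirror_in ?inside_lo.
have highE i j j' : M true i (hi j) (hi j') = low E i j j'.
  by rewrite /M mirror_rev -lowE.
have crossE i j j' : M true i (lo j) (hi j') = low E i j j' && crosses true (E i) (lo j).
  by rewrite /M mirror_in_out ?inside_lo ?outside_hi // rev_ordK.
apply/idP/and3P => [/(compatible_glue _ _ (sM true)) [H1 H2 H3]|[/innerP H1 /innerP H2]].
  split; first by apply/innerP => i j j' jj'; apply: H1; rewrite lowE.
    by apply/innerP => i j j' jj'; apply: H2; rewrite highE.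
  by apply/keylo_keylo => i j cj; apply: H3; rewrite crossE cj andbT; apply: rE.
move=> /keylo_keylo H3; apply/(compatible_glue _ _ (sM true)); split=> i j j'.
- by rewrite lowE; apply: H1.
- by rewrite highE; apply: H2.
- by rewrite crossE => /andP[/H2 <- /H3].
Qed.

Lemma compatible_mirror_false h g : compatible (M false) (glue h g) =
  [&& inner (high E) h, inner (high E) g & keyhi E h == keyhi E g].
Proof.
have highE i j j' : M false i (hi j) (hi j') = high E i j j'.
  by rewrite /M mirror_in ?inside_hi.
have lowE i j j' : M false i (lo j) (lo j') = high E i j j'.
  by rewrite /M -mirror_rev -highE.
have crossE i j j' : M false i (lo j) (hi j') = high E i j j' && crosses false (E i) (hi j').
  by rewrite sM /M mirror_in_out ?inside_hi ?outside_lo // sE.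
apply/idP/and3P => [/(compatible_glue _ _ (sM false)) [H1 H2 H3]|[h1 h2]].
  have h1 : inner (high E) h by apply/innerP => i j j' jj'; apply: H1; rewrite lowE.
  have h2 : inner (high E) g by apply/innerP => i j j' jj'; apply: H2; rewrite highE.
  split=> //; apply/keyhi_keyhi => // i j cj; apply: H3.
  by rewrite crossE cj andbT; apply: rE.
move=> /(keyhi_keyhi h1 h2) H3; apply/(compatible_glue _ _ (sM false)).
move/innerP: h1 => h1; move/innerP: h2 => h2; split=> i j j'.
- by rewrite lowE; apply: h1.
- by rewrite highE; apply: h2.
- by rewrite crossE => /andP[/h1 -> /H3].
Qed.

(** Cauchy-Schwarz over the values taken on the crossing blocks. *)
Theorem wordsum_cauchy_schwarz e :
  `|wordsum e E| ^+ 2 <= wordsum e (M true) * wordsum e (M false).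
Proof.
rewrite (wordsum_slices _ compatible_halves) (wordsum_slices _ compatible_mirror_true).
by rewrite (wordsum_slices _ compatible_mirror_false); apply: cauchy_schwarz_tr.
Qed.

Lemma wordsum_mirror_ge0 s e : 0 <= wordsum e (M s).
Proof.
case: s; [rewrite (wordsum_slices _ compatible_mirror_true)
         |rewrite (wordsum_slices _ compatible_mirror_false)];
by apply: sumr_ge0 => t _; apply: mxtrace_mul_adj_ge0.
Qed.

Variable o : 'I_n.

Let I i := isolate o (M true i).

Let sI i : symmetric (I i).
Proof. by have [_ h _] := isolate_equiv o (mirror_equiv true (eE i)). Qed.

Lemma compatible_isolate h g : compatible I (glue h g) =
  [&& inner (low I) h, inner (low I) g & keylo E h == keylo E g].
Proof.
have highE i j j' : I i (hi j) (hi j') = low I i j j'.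
  by rewrite /low /I /isolate /M mirror_rev !ends_rev.
have crossE i j j' : I i (lo j) (hi j') = low I i j j' && crosses true (E i) (lo j).
  rewrite /low /I /isolate /M mirror_in_out ?inside_lo ?outside_hi // rev_ordK ends_rev.
  by rewrite (mirror_in (E i) (inside_lo j) (inside_lo j')) andbAC.
apply/idP/and3P => [/(compatible_glue _ _ sI) [H1 H2 H3]|[/innerP H1 /innerP H2]].
  split; first by apply/innerP.
    by apply/innerP => i j j' jj'; apply: H2; rewrite highE.
  apply/keylo_keylo => i j cj; apply: H3; rewrite crossE cj andbT.
  by have [rI _ _] := isolate_equiv o (mirror_equiv true (eE i)); apply: rI.
move=> /keylo_keylo H3; apply/(compatible_glue _ _ sI); split=> i j j'.
- exact: H1.
- by rewrite highE; apply: H2.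
- by rewrite crossE => /andP[/H2 <- /H3].
Qed.

(** Both sides are sums of squared Hilbert-Schmidt norms of slices.  Splitting off the
    ends removes constraints that only concern crossing blocks: for given boundary
    data t, the slice is unchanged if t satisfies these constraints, and the old slice
    is zero otherwise. *)
Lemma wordsum_isolate e : inside true o -> wordsum e (M true) <= wordsum e I.
Proof.
move=> ino; rewrite (wordsum_slices _ compatible_mirror_true) (wordsum_slices _ compatible_isolate).
apply: ler_sum => t _.
have [h0 /andP[h0c /eqP h0t]|none] := pickP (fun h => inner (low E) h && (keylo E h == t)).
  suff -> : slice e (inner (low E)) (keylo E) t = slice e (inner (low I)) (keylo E) t by [].
  apply: eq_bigl => h; case: eqP => [ht|]; last by rewrite !andbF.
  rewrite !andbT; apply/innerP/innerP => H i j j'.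
    by move=> /isolate_sub jj'; apply: H; move: jj'; rewrite /M mirror_in ?inside_lo.
  move=> jj'; have [/H //|] := boolP (low I i j j').
  rewrite /low /I /isolate /M (mirror_in (E i) (inside_lo j) (inside_lo j')).
  rewrite -/(low E i j j') jj'.
  rewrite /= negb_imply mirror_self // => /andP[co ne].
  have toE k : ends o (lo k) -> lo k = o.
    by case/orP=> /eqP // kE; have := inside_lo k; rewrite kE inside_rev ino.
  have cj : crosses true (E i) (lo j) && crosses true (E i) (lo j').
    rewrite -(eq_crosses true (eE i) jj') andbb.
    have [/toE -> //|nj] := boolP (ends o (lo j)).
    move: ne; rewrite (negbTE nj) eq_sym eqbF_neg negbK => /toE j'o.
    by rewrite (eq_crosses true (eE i) jj') j'o.
  have /keylo_keylo key : keylo E h == keylo E h0 by rewrite ht h0t.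
  case/andP: cj => cj cj'; rewrite (key _ _ cj) (key _ _ cj').
  by move/innerP: h0c; apply.
rewrite {1 2}/slice !big_pred0 // mul0mx mxtrace0; exact: mxtrace_mul_adj_ge0.
Qed.

End Equiv.

End Sums.

(** * The extremal argument *)

Section Extremal.
Variables (m d : nat).
Hypothesis m_gt1 : 1 < m.
Local Notation n := (2 * m)%N.
Implicit Types (E : 'I_d -> rel 'I_n) (e : bool) (o x y z : 'I_n).

(** The families of relations, one per label, that come from partitions in
    NC*(d, m) or are obtained from these by symmetrization. *)
Definition admissible e E : Prop :=
  [/\ forall i, is_equiv (E i), forall i, alternating (E i)
    & forall i j : 'I_d, i < j -> uncrossed e (E i) (E j)].

(** The numbers of blocks B of the labels, and the number of good elements. *)
Definition opens e E : {ffun 'I_d -> nat} := [ffun i => nb_open e (E i)].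
Definition goods E : nat := \sum_i nb_good (E i).

Definition mirrors s E i := mirror s (E i).
Definition rots E i := rot (E i).
Definition isolates o E i := isolate o (E i).

Lemma admissible_mirrors s e E : admissible e E -> admissible e (mirrors s E).
Proof.
case=> h1 h2 h3; split=> [i|i|i j ij]; first exact: mirror_equiv.
  exact: mirror_alt.
exact/uncrossed_mirror/h3.
Qed.

Lemma admissible_rots e E : admissible e E -> admissible (~~ e) (rots E).
Proof.
case=> h1 h2 h3; split=> [i|i|i j ij]; first exact: rot_equiv.
  exact: rot_alt.
exact/uncrossed_rot/h3.
Qed.

Lemma admissible_isolates o e E : o = 0 :> nat -> admissible e E -> admissible e (isolates o E).
Proof.
move=> o0 [h1 h2 h3]; split=> [i|i|i j ij]; first exact: isolate_equiv.
  exact: isolate_alt.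
by apply: uncrossed_sub (h3 _ _ ij) => x y; apply: isolate_sub.
Qed.

Lemma opens_mirrors e E : admissible e E ->
  forall i, opens e (mirrors true E) i + opens e (mirrors false E) i = 2 * opens e E i.
Proof. by case=> h1 h2 _ i; rewrite !ffunE nb_open_mirror. Qed.

Lemma opens_rots e E : admissible e E -> opens (~~ e) (rots E) = opens e E.
Proof.
by case=> h1 h2 _; apply/ffunP => i; rewrite !ffunE nb_open_rot // (ltn_trans _ m_gt1).
Qed.

Lemma opens_isolates o E : o = 0 :> nat -> admissible false E ->
  opens false (isolates o E) = opens false E.
Proof. by move=> o0 [h1 h2 _]; apply/ffunP => i; rewrite !ffunE nb_open_isolate. Qed.

Lemma goods_rots E : goods (rots E) = goods E.
Proof. by apply: eq_bigr => i _; rewrite nb_good_rot. Qed.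

Lemma sum_lt2 (f g h : 'I_d -> nat) i : (forall j, 2 * h j <= f j + g j) ->
  2 * h i < f i + g i -> 2 * (\sum_j h j) < \sum_j f j + \sum_j g j.
Proof.
move=> le lt; rewrite -big_split big_distrr /= (bigD1 i) //= [X in _ < X](bigD1 i) //=.
by rewrite -addSn; apply: leq_add => //; apply: leq_sum.
Qed.

Local Open Scope ring_scope.
Variables (R : realFieldType) (value : bool -> ('I_d -> rel 'I_n) -> R).
Variable bound : {ffun 'I_d -> nat} -> R.
Hypothesis value_ext : forall e E E',
  (forall i x y, E i x y = E' i x y) -> value e E = value e E'.
Hypothesis value_ge0 : forall e E, 0 <= value e E.
Hypothesis value_rot : forall e E, value (~~ e) (rots E) = value e E.
Hypothesis value_mirror : forall e E, admissible e E ->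
  value e E ^+ 2 <= value e (mirrors true E) * value e (mirrors false E).
Hypothesis value_isolate : forall o e E, o = 0%N :> nat -> admissible e E ->
  value e (mirrors true E) <= value e (isolates o (mirrors true E)).
Hypothesis bound_gt0 : forall w, 0 < bound w.
Hypothesis bound_mid : forall w w1 w2 : {ffun 'I_d -> nat},
  (forall i, w1 i + w2 i = 2 * w i)%N -> bound w1 * bound w2 = bound w ^+ 2.
Hypothesis value_terminal : forall E, admissible true E ->
  (forall i x, good (E i) x) -> value true E <= bound (opens true E).

Section Extremal_states.
Variable c : R.
Hypothesis c_gt0 : 0 < c.
Hypothesis c_max : forall e E, admissible e E -> value e E <= c * bound (opens e E).
Variable N : nat.
Hypothesis N_max : forall e E, admissible e E -> value e E = c * bound (opens e E) ->
  (goods E <= N)%N.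

(** The families at which the ratio of the value to its bound attains its maximum c
    and which have as many good elements as possible. *)
Definition extremal e E : Prop :=
  [/\ admissible e E, value e E = c * bound (opens e E) & goods E = N].

Lemma extremal_rots e E : extremal e E -> extremal (~~ e) (rots E).
Proof.
case=> h1 h2 h3; split; first exact: admissible_rots.
  by rewrite value_rot opens_rots.
by rewrite goods_rots.
Qed.

(** As c is maximal, equality holds in the Cauchy-Schwarz inequality, so that E1 and
    E2 reach the ratio c as well. *)
Lemma extremal_no_gain e E E1 E2 : extremal e E -> admissible e E1 -> admissible e E2 ->
  value e E ^+ 2 <= value e E1 * value e E2 ->
  (forall i, opens e E1 i + opens e E2 i = 2 * opens e E i)%N ->
  (goods E1 + goods E2 <= 2 * goods E)%N.
Proof.
move=> [aE vE gE] a1 a2 v12 /bound_mid b12.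
have [le1 le2] := (c_max a1, c_max a2).
have b1 := bound_gt0 (opens e E1); have b2 := bound_gt0 (opens e E2).
have p1 : 0 < c * bound (opens e E1) by rewrite mulr_gt0.
have p2 : 0 < c * bound (opens e E2) by rewrite mulr_gt0.
have key : c * bound (opens e E1) * (c * bound (opens e E2)) <= value e E1 * value e E2.
  apply: le_trans v12; rewrite vE mulrACA b12 -expr2 -exprMn; exact: lexx.
have e1 : value e E1 = c * bound (opens e E1).
  apply/eqP; rewrite eq_le le1 /= -(ler_pM2r p2); apply: le_trans key _.
  by rewrite ler_wpM2l.
have e2 : value e E2 = c * bound (opens e E2).
  apply/eqP; rewrite eq_le le2 /= -(ler_pM2l p1); apply: le_trans key _.
  by rewrite ler_wpM2r.
by rewrite gE mul2n -addnn leq_add // (N_max _ e1, N_max _ e2).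
Qed.

(** Rotating x to the origin. *)
Lemma extremal_move e E i (o x : 'I_n) : extremal e E -> o = 0%N :> nat -> ~~ good (E i) x -> odd x = e ->
  exists E', extremal false E' /\ ~~ good (E' i) o.
Proof.
move=> + o0; have [k] := ubnP (val x); elim: k x e E => // k IHk x e E lt tE gx ox.
have [x0|x0] := posnP x.
  have xo : x = o by apply: val_inj; rewrite /= x0 o0.
  by exists E; rewrite -xo; split=> //; move: tE; rewrite -ox x0.
have := ordS_val (ord_pred x); rewrite ord_predK => -[[xv _]|[xv _]]; last by rewrite xv in x0.
apply: (IHk (ord_pred x) (~~ e) (rots E)).
- by have: (x < k.+1)%N := lt; rewrite xv ltnS.
- exact: extremal_rots.
- by rewrite /rots good_rot ord_predK.
- by rewrite -ox xv /= negbK.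
Qed.

(** A bad block contains an element of parity e, which is rotated to the origin.  By
    gain_isolate this block is then contained in the lower half; one more rotation
    sends the origin to the last position and gain_last applies. *)
Lemma extremal_good e E : extremal e E -> forall i x, good (E i) x.
Proof.
move=> tE i x; have [//|gx] := boolP (good (E i) x); exfalso.
have m0 : (0 < m)%N by apply: ltn_trans m_gt1.
have n0 : (0 < n)%N by rewrite muln_gt0.
pose o : 'I_n := Ordinal n0.
have o0 : o = 0%N :> nat by [].
(* The block of x has an element of parity e, which is not good either. *)
have [x' gx' ox'] : exists2 x', ~~ good (E i) x' & odd x' = e.
  have [ox|ox] := eqVneq (odd x) e; first by exists x; [exact: gx|exact: ox].
  have [[eqE altE _] _ _] := tE; have [rE sE trE] := eqE i.
  have [z [xz oz _]] := altE i x x (rE x) erefl.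
  exists z; last by move: ox oz; case: (odd x); case: (odd z); case: e {tE}.
  apply: contra gx => /goodP[y a h].
  have /orP[/eqP xz'|/eqP xy] : (x == z) || (x == y) by rewrite -h sE.
    by apply/goodP; exists y; rewrite xz'.
  apply/goodP; exists z; first by rewrite xy /adjacent orbC.
  move=> u; have -> : E i x u = E i z u.
    by apply/idP/idP => hu; apply: trE hu; rewrite ?xz // sE.
  by rewrite h xy orbC.
have [E' [tE' go]] := extremal_move tE o0 gx' ox'.
have [aE' _ _] := tE'; have [eqE altE _] := aE'; have [rE sE trE] := eqE i.
(* A crossing block of 0 would give a gain after splitting off the ends. *)
have nc : ~~ crosses true (E' i) o.
  apply/negP => co.
  have aM := admissible_mirrors true aE'.
  have aI := admissible_isolates o0 aM; have aF := admissible_mirrors false aE'.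
  have v : value false E' ^+ 2 <=
      value false (isolates o (mirrors true E')) * value false (mirrors false E').
    apply: le_trans (value_mirror aE') _; apply: ler_wpM2r => //; exact: value_isolate.
  have w j : (opens false (isolates o (mirrors true E')) j + opens false (mirrors false E') j =
      2 * opens false E' j)%N by rewrite opens_isolates // opens_mirrors.
  have := extremal_no_gain tE' aI aF v w; apply/negP; rewrite -ltnNge.
  apply: (@sum_lt2 _ _ _ i); last by have [h _ _] := aE'; apply: gain_isolate.
  have [h _ _] := aE'; move=> j; apply: leq_trans (nb_good_mirror_le (h j)) _.
  by rewrite leq_add2r; apply: nb_good_isolate => //; apply: mirror_equiv.
have low z : E' i o z -> (z < m)%N.
  move=> oz; rewrite ltnNge; apply: contra nc => mz; apply/crossesP; exists z => //.
  by rewrite /inside -leqNgt.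
have [z [oz oddz _]] := altE i o o (rE o) erefl.
(* After one more rotation the former origin comes last, and it is the only element
   of its block in the upper half. *)
have tE2 := extremal_rots tE'; set E2 := rots E' in tE2; have [a2 _ _] := tE2.
have lastS := ordS_last o0.
have := extremal_no_gain tE2 (admissible_mirrors true a2) (admissible_mirrors false a2)
  (value_mirror a2) (opens_mirrors a2).
apply/negP; rewrite -ltnNge; have [eq2 _ _] := a2.
apply: (@sum_lt2 _ _ _ i) => [j|]; first exact: nb_good_mirror_le.
apply: (@gain_last _ o _ (ord_pred z)) => //.
- by rewrite good_rot lastS.
- move=> y; rewrite /E2 /rots /rot lastS => /low; case: (ordS_val y) => -[-> ].
    by move=> _ /ltnW lt; rewrite leqNgt lt.
  by move=> yn _ _; apply/ord_inj; rewrite rev_val o0 subn1; apply: (congr1 predn yn).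
- by rewrite /E2 /rots /rot lastS ord_predK.
- have z0 : z <> o by move=> zo; move: oddz; rewrite zo eqxx.
  have := ordS_val (ord_pred z); rewrite ord_predK => -[[zv _]|[zv _]].
    by apply: leq_trans (low z oz); rewrite zv ltnS.
  by case: z0; apply/ord_inj; rewrite zv.
Qed.

End Extremal_states.

(** The maximum exists because there are finitely many families, encoded here as sets
    of pairs. *)
Lemma value_le_bound e E : admissible e E -> value e E <= bound (opens e E).
Proof.
move=> aE.
pose state := (bool * {ffun 'I_d -> {set 'I_n * 'I_n}})%type.
pose fam (st : state) i : rel 'I_n := fun x y => (x, y) \in st.2 i.
pose code e E : state := (e, [ffun i => [set p | E i p.1 p.2]%SET]).
have famE e' E' i x y : fam (code e' E') i x y = E' i x y by rewrite /fam ffunE inE.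
have code_adm e' E' : admissible e' E' -> admissible e' (fam (code e' E')).
  move=> [h1 h2 h3]; split.
  - move=> i; have [rr sr tr] := h1 i; split; first by move=> x; rewrite famE.
      by move=> x y; rewrite !famE sr.
    by move=> y x z; rewrite !famE; apply: tr.
  - move=> i x y; rewrite famE => /h2 h /h [z [xz oz bz]].
    by exists z; rewrite famE.
  - move=> i j ij; apply: uncrossed_sub (h3 i j ij) => x y; by rewrite famE.
have code_opens e' E' : opens e' (fam (code e' E')) = opens e' E'.
  apply/ffunP => i; rewrite !ffunE /nb_open; congr addn; apply: eq_bigr => x _.
  congr nat_of_bool; congr andb; apply: eq_forallb => y; by rewrite famE.
have code_goods e' E' : goods (fam (code e' E')) = goods E'.
  apply: eq_bigr => i _; apply: eq_bigr => x _; congr nat_of_bool.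
  apply: eq_existsb => y; congr andb; apply: eq_forallb => z; by rewrite famE.
have code_value e' E' : value e' (fam (code e' E')) = value e' E'.
  exact: value_ext.
pose adm (st : state) : bool := `[< admissible st.1 (fam st) >].
pose ratio (st : state) : R := value st.1 (fam st) / bound (opens st.1 (fam st)).
have adm0 : adm (code e E) by apply/asboolP/code_adm.
have [st1 /asboolP adm1 max1] := @arg_maxP _ _ _ (code e E) adm ratio adm0.
set c := ratio st1.
have valueE e' E' : admissible e' E' ->
    value e' E' = ratio (code e' E') * bound (opens e' E').
  by move=> _; rewrite /ratio code_opens code_value divfK // gt_eqF.
have c_max e' E' : admissible e' E' -> value e' E' <= c * bound (opens e' E').
  move=> aE'; rewrite valueE // ler_pM2r //; apply: max1.
  exact/asboolP/code_adm.
have [c_le1|c_gt1] := leP c 1.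
  by apply: le_trans (c_max _ _ aE) _; rewrite -[leRHS]mul1r ler_pM2r.
(* Otherwise choose st2 among the maximizers of the ratio, with most good elements. *)
exfalso; have c_gt0 : 0 < c by apply: lt_trans c_gt1.
pose P st := adm st && (ratio st == c).
have P1 : P st1 by rewrite /P eqxx andbT; apply/asboolP.
have [st2 /andP[/asboolP adm2 /eqP ratio2] max2] :=
  @arg_maxnP _ st1 P (fun st => goods (fam st)) P1.
have N_max e' E' : admissible e' E' -> value e' E' = c * bound (opens e' E') ->
    (goods E' <= goods (fam st2))%N.
  move=> aE' vE'; rewrite -(code_goods e'); apply: max2; apply/andP; split.
    exact/asboolP/code_adm.
  by rewrite /ratio code_value code_opens vE' mulfK ?eqxx // gt_eqF.
have to_true e' E' : extremal c (goods (fam st2)) e' E' -> extremal c (goods (fam st2)) true (if e' then E' else rots E').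
  by case: e' => // /extremal_rots.
have tt : extremal c (goods (fam st2)) st2.1 (fam st2).
  by split=> //; rewrite -ratio2 /ratio divfK // (gt_eqF (bound_gt0 _)).
have := to_true _ _ tt; set E' := (if _ then _ else _) => tE'.
have gd := extremal_good c_gt0 c_max N_max tE'; case: tE' => aE' vE' _.
have := value_terminal aE' gd; rewrite vE' -[leRHS]mul1r ler_pM2r // leNgt.
by rewrite c_gt1.
Qed.

End Extremal.

(** * Relations all of whose blocks are pairs of neighbours *)

Section Path.
Local Open Scope ring_scope.
Local Open Scope sesquilinear_scope.
Variables (R : pzRingType) (T : finType) (k : nat).
Implicit Types (G H : T -> T -> 'M[R]_k) (u v w : T).

(** Products and powers of block matrices with finitely many blocks. *)
Definition kmul G H u v : 'M[R]_k := \sum_w G u w *m H w v.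

Definition kpow G p : T -> T -> 'M[R]_k :=
  iter p (kmul G) (fun u v => if u == v then 1%:M else 0).

Lemma sum_tuple_cons p (V : nmodType) (F : p.+1.-tuple T -> V) :
  \sum_(t : p.+1.-tuple T) F t = \sum_w \sum_(t : p.-tuple T) F [tuple of w :: t].
Proof.
rewrite pair_bigA /= (reindex (fun q : T * p.-tuple T => [tuple of q.1 :: q.2])) //=.
exists (fun t => (thead t, [tuple of behead t])) => [[w t] _|t _] /=.
  by rewrite theadE; congr pair; apply/val_inj.
by rewrite [RHS]tuple_eta.
Qed.

(** A power expanded as a sum over paths from u to v. *)
Lemma kpow_path G p u v : kpow G p.+1 u v =
  \sum_(t : p.-tuple T) \prod_(j < p.+1) G (nth u (u :: t) j) (nth u (rcons t v) j).
Proof.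
elim: p u => [|p IHp] u.
  rewrite (bigD1 ([tuple] : 0.-tuple T)) //= [X in _ = _ + X]big1 => [|t /eqP[]]; last by rewrite (tuple0 t).
  rewrite addr0 big_ord1 /= /kpow /= /kmul (bigD1 v) //= eqxx mulmx1 big1 ?addr0 // => w.
  by move/negbTE ->; rewrite mulmx0.
rewrite sum_tuple_cons; transitivity (\sum_w G u w *m kpow G p.+1 w v) => //.
apply: eq_bigr => w _; rewrite IHp mulmx_sumr; apply: eq_bigr => t _.
rewrite [in RHS]big_ord_recl /=; congr (_ *m _); apply: eq_bigr => j _ /=.
rewrite (set_nth_default u w) ?(set_nth_default u w) //= ?size_rcons size_tuple //.
Qed.

(** The trace of a power expanded as a sum over closed paths. *)
Lemma cyclic_path G p :
  \sum_(t : {ffun 'I_p.+1 -> T}) \tr (\prod_(j < p.+1) G (t j) (t (ordS j))) =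
  \sum_u \tr (kpow G p.+1 u u).
Proof.
transitivity (\sum_(t : p.+1.-tuple T) \tr (\prod_(j < p.+1) G (tnth t j) (tnth t (ordS j)))).
  rewrite (reindex (fun t : p.+1.-tuple T => [ffun j => tnth t j])) /=.
    by apply: eq_bigr => t _; congr (\tr _); apply: eq_bigr => j _; rewrite !ffunE.
  exists (fun t : {ffun 'I_p.+1 -> T} => [tuple t j | j < p.+1]) => t _.
    by apply/eq_from_tnth => j; rewrite tnth_mktuple ffunE.
  by apply/ffunP => j; rewrite ffunE tnth_mktuple.
rewrite sum_tuple_cons; apply: eq_bigr => u _.
rewrite kpow_path raddf_sum; apply: eq_bigr => t _; congr (\tr _).
apply: eq_bigr => j _; rewrite !(tnth_nth u) /=; congr (G _ _).
have := ltn_ord j; rewrite ltnS leq_eqVlt => /orP[/eqP jp|jp].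
  by rewrite jp modnn /= nth_rcons size_tuple ltnn eqxx.
by rewrite modn_small ?ltnS //= nth_rcons size_tuple jp.
Qed.

Lemma cyclic_path_pos G p : (0 < p)%N ->
  \sum_(t : {ffun 'I_p -> T}) \tr (\prod_(j < p) G (t j) (t (ordS j))) =
  \sum_u \tr (kpow G p u u).
Proof. by case: p => // p _; apply: cyclic_path. Qed.

End Path.

Section Pairs.
Local Open Scope ring_scope.
Local Open Scope sesquilinear_scope.
Variable m : nat.
Local Notation n := (2 * m)%N.
Implicit Types (x y z : 'I_n) (j : 'I_m) (r : rel 'I_n).

Lemma half_subproof x : (x./2 < m)%N.
Proof. by have := ltn_ord x; ord_lia. Qed.
(** The intervals 2j and 2j + 1 form the j-th pair; ev j and od j are its elements. *)
Definition pair_index x : 'I_m := Ordinal (half_subproof x).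

Lemma double_subproof j : (2 * j < n)%N.
Proof. by rewrite ltn_pmul2l. Qed.
Definition ev j : 'I_n := Ordinal (double_subproof j).
Definition od j : 'I_n := ordS (ev j).

Lemma odE j : od j = (2 * j).+1 :> nat.
Proof. by rewrite /od; case: (ordS_val (ev j)) => -[-> ] //=; have := ltn_ord j; ord_lia. Qed.

Lemma pair_indexE x : pair_index x = x./2 :> nat. Proof. by []. Qed.
Lemma pair_index_ev j : pair_index (ev j) = j. Proof. by apply/ord_inj; rewrite pair_indexE /=; ord_lia. Qed.
Lemma pair_index_od j : pair_index (od j) = j. Proof. by apply/ord_inj; rewrite pair_indexE odE; ord_lia. Qed.
Lemma pair_index_ordS_od j : pair_index (ordS (od j)) = ordS j.
Proof.
apply/ord_inj; rewrite pair_indexE; have := ordS_val (od j); rewrite odE => -[[-> h]|[-> h]] /=.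
  by rewrite modn_small; move: h; ord_lia.
have -> : j.+1 = m by move: h; ord_lia.
by rewrite modnn.
Qed.

Lemma ev_od x : x = ev (pair_index x) \/ x = od (pair_index x).
Proof.
case: (boolP (odd x)) => ox; [right|left]; apply/ord_inj; rewrite ?odE /=; move: ox; ord_lia.
Qed.

(** Grouping the factors of a product by pairs. *)
Lemma big_pairs (R : Type) (idx : R) (op : Monoid.law idx) (F : 'I_n -> R) :
  \big[op/idx]_(x < n) F x = \big[op/idx]_(j < m) op (F (ev j)) (F (od j)).
Proof.
pose f (x : nat) := if insub x is Some i then F i else idx.
have fE x : f x = F x by rewrite /f valK.
have H p : \big[op/idx]_(0 <= x < 2 * p) f x =
    \big[op/idx]_(0 <= j < p) op (f (2 * j)%N) (f (2 * j).+1).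
  elim: p => [|p IHp]; first by rewrite muln0 !big_geq.
  by rewrite mulnS !big_nat_recr //= IHp Monoid.mulmA.
transitivity (\big[op/idx]_(x < n) f x); first by apply: eq_bigr => x _; rewrite fE.
rewrite -(big_mkord xpredT f) H big_mkord; apply: eq_bigr => j _.
by rewrite -odE -fE -[F (od j)]fE.
Qed.

(** If 0 is paired with 1, then 2 cannot be paired with 1, hence is paired with 3, and
    so on. *)
Lemma good_even r : is_equiv r -> (forall x, good r x) ->
  (forall x, x = 0%N :> nat -> r x (ordS x)) ->
  forall j, r (ev j) (od j).
Proof.
move=> [rr sr tr] gr r0 j; case: j => k km; elim: k km => [|k IHk] km; first by apply: r0.
have km' : (k < m)%N by apply: ltnW.
set j' := Ordinal km; set j := Ordinal km'; have /goodP[p a h] := gr (ev j').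
have odj : ordS (od j) = ev j'.
  apply/ord_inj; case: (ordS_val (od j)) => -[-> ]; rewrite odE /=; first by ord_lia.
  by have := km; ord_lia.
case/orP: a => [/eqP pE|/eqP].
  by rewrite h /od pE eqxx orbT.
rewrite -odj => /(@ordS_inj _) jp.
have /goodP[q a' h'] := gr (ev j).
have neq : od j == ev j = false by apply/negbTE; rewrite -(inj_eq (@ord_inj _)) odE /=; ord_lia.
have jq : q = od j by have := IHk km'; rewrite -/j h' neq /= => /eqP.
have : r (ev j) (ev j').
  apply: (tr (od j)); first exact: IHk.
  by rewrite sr h jp eqxx orbT.
rewrite h' jq => /orP[] /eqP/(congr1 (@nat_of_ord _)); rewrite ?odE /=; ord_lia.
Qed.

Lemma good_pairs r : is_equiv r -> (forall x, good r x) ->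
  (forall x, x = 0%N :> nat -> r x (ordS x)) ->
  forall x y, r x y = (pair_index x == pair_index y).
Proof.
move=> er gr r0 x y; have pair := good_even er gr r0; have [rr sr tr] := er.
have rx u : r u (ev (pair_index u)) by case: (ev_od u) => {1}->; rewrite // sr.
apply/idP/eqP => [xy|xy]; last first.
  by apply: tr (rx x) _; rewrite xy sr.
have /goodP[q a h] := gr (ev (pair_index x)).
have : r (ev (pair_index x)) y by apply: tr xy; rewrite sr.
have qE : q = od (pair_index x).
  have := pair (pair_index x); rewrite h => /orP[|/eqP //].
  by rewrite -(inj_eq (@ord_inj _)) odE /=; ord_lia.
by rewrite h qE => /orP[] /eqP ->; rewrite ?pair_index_ev ?pair_index_od.
Qed.

(** The two ways of pairing neighbours: 2j with 2j + 1, or 2j + 1 with 2j + 2. *)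
Definition near_pairs : rel 'I_n := fun x y => pair_index x == pair_index y.
Definition far_pairs : rel 'I_n := rot near_pairs.

Lemma good_near_or_far r : is_equiv r -> (forall x, good r x) ->
  (forall x y, r x y = near_pairs x y) \/ (forall x y, r x y = far_pairs x y).
Proof.
move=> er gr; have [rr sr tr] := er.
have [m0|m0] := posnP m.
  by left=> x; have := ltn_ord x; rewrite {2}m0.
have n0 : (0 < n)%N by rewrite muln_gt0.
pose o : 'I_n := Ordinal n0.
have oE x : x = 0%N :> nat -> x = o by move=> x0; apply/ord_inj.
have [roS|noS] := boolP (r o (ordS o)).
  by left; apply: good_pairs => // x /oE ->.
right; pose r' : rel 'I_n := fun x y => r (ord_pred x) (ord_pred y).
have rot_r' x y : rot r' x y = r x y by rewrite /rot /r' !ordSK.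
have er' : is_equiv r'.
  by split=> [x|x y|x y z]; rewrite /r'; [apply: rr|apply: sr|apply: tr].
have gr' x : good r' x.
  rewrite -[x]ord_predK -good_rot; have /goodP[y a h] := gr (ord_pred x).
  by apply/goodP; exists y => // z; rewrite rot_r'.
have r'0 x : x = 0%N :> nat -> r' x (ordS x).
  move=> /oE ->; rewrite /r' ordSK sr; have /goodP[y a h] := gr o; rewrite h.
  case/orP: a => /eqP ya; last by rewrite ya ordSK eqxx orbT.
  by move: noS; rewrite h ya eqxx orbT.
by move=> x y; rewrite -rot_r' /rot (good_pairs er' gr' r'0).
Qed.

Lemma nb_open_near e : nb_open e near_pairs = if e then 1%N else m.
Proof.
have minE x : block_min near_pairs x = ~~ odd x.
  case: (ev_od x) => {1 2}->.
    have -> : ~~ odd (ev (pair_index x)) by rewrite /= oddM.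
    apply/block_minP => y /eqP; rewrite pair_index_ev => <- /=.
    by have := ltn_ord y; ord_lia.
  rewrite odE /= oddM /=; apply/negbTE/block_minP.
  move=> /(_ (ev (pair_index x))); rewrite /near_pairs pair_index_ev pair_index_od eqxx odE => /(_ isT) /=.
  by rewrite ltnn.
rewrite /nb_open big_pairs /=.
under eq_bigr => j _ do rewrite !minE odE [nat_of_ord (ev j)]/= [odd _.+1]/= !oddM /= andbF addn0 andbT.
by rewrite sum_nat_const card_ord; case: e; rewrite ?muln0 ?muln1 ?addn0.
Qed.

Lemma nb_open_far e : (0 < m)%N -> alternating near_pairs -> nb_open e far_pairs = if e then m else 1%N.
Proof.
move=> m0 al; rewrite -[e]negbK nb_open_rot // ?nb_open_near; first by case: e.
by split=> [x|x y|x y z]; rewrite /near_pairs // => /eqP -> /eqP ->.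
Qed.

End Pairs.

Section Terminal.
Local Open Scope ring_scope.
Local Open Scope sesquilinear_scope.
Variables (m d : nat).
Hypothesis m_gt1 : (1 < m)%N.
Local Notation n := (2 * m)%N.

Lemma near_alternating : alternating (@near_pairs m).
Proof.
move=> x y /eqP/(congr1 (@nat_of_ord _)); rewrite !pair_indexE => xy oxy.
have <- : x = y by apply/ord_inj; move: xy oxy; ord_lia.
have [xE|xE] := ev_od x.
  exists (od (pair_index x)); rewrite /near_pairs pair_index_od eqxx /btw leqnn odE; split=> //=.
    by move: xE => /(congr1 (@nat_of_ord _)) /=; ord_lia.
  by move: xE => /(congr1 (@nat_of_ord _)) /=; ord_lia.
exists (ev (pair_index x)); rewrite /near_pairs pair_index_ev eqxx /btw leqnn; split=> //.
  by move: xE => /(congr1 (@nat_of_ord _)); rewrite odE /=; ord_lia.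
by move: xE => /(congr1 (@nat_of_ord _)); rewrite odE /=; ord_lia.
Qed.

(** The chord {1, 2} of the smaller label separates the ends of {2, 3}. *)
Lemma far_near_crossed (r1 r2 : rel 'I_n) : (forall x y, r1 x y = far_pairs x y) ->
  (forall x y, r2 x y = near_pairs x y) -> ~ uncrossed true r1 r2.
Proof.
move=> h1 h2.
have n3 : (3 < n)%N by move: m_gt1; clear; lia.
pose x1 : 'I_n := Ordinal (ltnW (ltnW n3)); pose x2 : 'I_n := Ordinal (ltnW n3).
pose x3 : 'I_n := Ordinal n3.
have S1 : ordS x1 = x2 by apply/ord_inj; rewrite /= modn_small // ltnW.
have S2 : ordS x2 = x3 by apply/ord_inj; rewrite /= modn_small.
move=> /(_ x1 x2 x2 x3); rewrite h1 h2 /far_pairs /rot S1 S2 /near_pairs.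
by rewrite -!(inj_eq (@ord_inj _)) !pair_indexE /= => /(_ isT isT).
Qed.

(** By the previous lemma, the labels paired as in near_pairs form an initial
    segment. *)
Lemma terminal_shape (E : 'I_d -> rel 'I_n) : (forall i, is_equiv (E i)) ->
  (forall i x, good (E i) x) -> (forall i j : 'I_d, (i < j)%N -> uncrossed true (E i) (E j)) ->
  exists l : 'I_d.+1, forall i x y, E i x y = if (i < l)%N then near_pairs x y else far_pairs x y.
Proof.
move=> eE gE uE.
have n0 : (0 < n)%N by move: m_gt1; clear; lia.
pose p (i : 'I_d) := ~~ [forall x, forall y, E i x y == near_pairs x y].
have near i : ~~ p i -> forall x y, E i x y = near_pairs x y.
  by rewrite negbK => /forallP h x y; have /forallP/(_ y)/eqP := h x.
have far i : p i -> forall x y, E i x y = far_pairs x y.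
  move=> pi; case: (good_near_or_far (eE i) (gE i)) => // h.
  by case/negP: pi; apply/forallP => x; apply/forallP => y; rewrite h.
have [i0 pi0|none] := pickP p; last first.
  by exists ord_max => i x y; rewrite ltn_ord near ?none.
have [i1 pi1 min1] := @arg_minnP _ i0 p (@nat_of_ord d) pi0.
exists (widen_ord (leqnSn d) i1) => i x y /=; case: ltnP => ii1.
  by apply: near; apply: contraL ii1 => /min1; rewrite -leqNgt.
have [/far //|/near ni] := boolP (p i).
have lt : (i1 < i)%N.
  rewrite ltn_neqAle ii1 andbT; apply/eqP => /ord_inj ii.
  by case/negP: pi1; apply/forallP => u; apply/forallP => v; rewrite ii ni.
by case: (far_near_crossed (far _ pi1) ni (uE _ _ lt)).
Qed.

Variables (C : numClosedFieldType) (alpha : nat) (U : finType).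
Notation V := {ffun 'I_d -> U}.
Variable a : V -> 'M[C]_alpha.
Variable l : 'I_d.+1.
Notation Vl := {ffun 'I_l -> U}.
Notation Vr := {ffun 'I_(d - l) -> U}.

Lemma mix_subproof : (d = l + (d - l))%N.
Proof. by rewrite subnKC // leq_ord. Qed.

(** The multi-index of length d made of s of length l and t of length d - l, and the
    two inverse projections. *)
Definition mix (s : Vl) (t : Vr) : V :=
  [ffun i => match fintype.split (cast_ord mix_subproof i) with inl j => s j | inr j => t j end].
Definition projl (v : V) : Vl := [ffun j => v (cast_ord (esym mix_subproof) (lshift _ j))].
Definition projr (v : V) : Vr := [ffun j => v (cast_ord (esym mix_subproof) (rshift _ j))].

Lemma projl_mix s t : projl (mix s t) = s.
Proof. by apply/ffunP => j; rewrite !ffunE cast_ordKV (unsplitK (inl j)). Qed.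

Lemma projr_mix s t : projr (mix s t) = t.
Proof. by apply/ffunP => j; rewrite !ffunE cast_ordKV (unsplitK (inr j)). Qed.

Lemma mix_proj u v i : mix (projl u) (projr v) i = if (i < l)%N then u i else v i.
Proof.
rewrite ffunE; case: (fintype.splitP (cast_ord mix_subproof i)) => j /= ij; rewrite ffunE.
  by congr (u _); apply/ord_inj.
by congr (v _); apply/ord_inj.
Qed.

Lemma mix_eq s t s' t' (i : 'I_d) :
  (if (i < l)%N then s == s' else t == t') -> mix s t i = mix s' t' i.
Proof. by rewrite !ffunE; case: (fintype.splitP (cast_ord mix_subproof i)) => j /= _ /eqP ->. Qed.

(** The blocks of the product of the adjoint of M_l with M_l. *)
Definition gram (t t' : Vr) : 'M[C]_alpha :=
  \sum_(s : Vl) (a (mix s t)) ^t* *m a (mix s t').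

(** Compatible words are exactly those of the form k(2j) = (s_j, t_j) and
    k(2j + 1) = (s_j, t_(j+1)), indices j being cyclic, and summing over s turns each
    pair of letters into a block of gram. *)
Lemma wordsum_terminal (E : 'I_d -> rel 'I_n) :
  (forall i x y, E i x y = if (i < l)%N then near_pairs x y else far_pairs x y) ->
  wordsum a true E = \sum_t \tr (kpow gram m t t).
Proof.
move=> hE; rewrite /wordsum.
pose h (q : {ffun 'I_m -> Vr} * {ffun 'I_m -> Vl}) : {ffun 'I_n -> V} :=
  [ffun x => mix (q.2 (pair_index x)) (q.1 (pair_index (ordS x)))].
pose g (k : {ffun 'I_n -> V}) : {ffun 'I_m -> Vr} * {ffun 'I_m -> Vl} :=
  ([ffun j => projr (k (ev j))], [ffun j => projl (k (ev j))]).
have hg k : compatible E k -> h (g k) = k.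
  move=> /compatibleP ck; apply/ffunP => x; apply/ffunP => i; rewrite ffunE.
  rewrite [(g k).2 _]ffunE [(g k).1 _]ffunE mix_proj.
  case: ifP => il; apply: ck; rewrite hE il; first by rewrite /near_pairs pair_index_ev.
  by rewrite /far_pairs /rot /near_pairs -/(od _) pair_index_od.
have gh q : g (h q) = q.
  case: q => t s; congr pair; apply/ffunP => j; rewrite !ffunE ?projr_mix ?projl_mix /=.
    by rewrite -/(od j) pair_index_od.
  by rewrite pair_index_ev.
have ch q : compatible E (h q).
  apply/compatibleP => i x y; rewrite hE [h q x]ffunE [h q y]ffunE => hxy; apply: mix_eq.
  by move: hxy; case: ifP => _ /eqP ->.
rewrite (reindex_onto h g) /=; last by move=> k; apply: hg.
under eq_bigl => q do rewrite ch gh eqxx.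
rewrite -(pair_bigA _ (fun t s => \tr (word a true (h (t, s))))) /=.
rewrite -cyclic_path_pos ?(ltn_trans _ m_gt1) //; apply: eq_bigr => t _.
rewrite -raddf_sum /=; congr (\tr _).
rewrite /gram bigA_distr_bigA; apply: eq_bigr => s _.
rewrite /word big_pairs; apply: eq_bigr => j _.
rewrite [h _ (ev j)]ffunE [h _ (od j)]ffunE [(t, s).1]/= [(t, s).2]/=.
by rewrite pair_index_ordS_od -/(od j) !pair_index_od pair_index_ev odE /letter /= oddM.
Qed.

End Terminal.

(** * Positivity of traces of powers *)

Section Kernels.
Local Open Scope ring_scope.
Local Open Scope sesquilinear_scope.
Variables (R : pzRingType) (T : finType) (k : nat).
Implicit Types (X Y Z : T -> T -> 'M[R]_k) (u v w : T).

Lemma kmulA X Y Z u v : kmul X (kmul Y Z) u v = kmul (kmul X Y) Z u v.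
Proof.
rewrite /kmul; transitivity (\sum_w \sum_x X u w *m Y w x *m Z x v).
  by apply: eq_bigr => w _; rewrite mulmx_sumr; apply: eq_bigr => x _; rewrite mulmxA.
by rewrite exchange_big; apply: eq_bigr => x _; rewrite mulmx_suml.
Qed.

Lemma eq_kmul X X' Y Y' : (forall u v, X u v = X' u v) -> (forall u v, Y u v = Y' u v) ->
  forall u v, kmul X Y u v = kmul X' Y' u v.
Proof. by move=> hX hY u v; apply: eq_bigr => w _; rewrite hX hY. Qed.

Lemma kpow0l X Y u v : kmul (kpow X 0) Y u v = Y u v.
Proof.
rewrite /kmul (bigD1 u) //= /kpow /= eqxx mul1mx big1 ?addr0 // => w.
by rewrite eq_sym => /negbTE ->; rewrite mul0mx.
Qed.

Lemma kpow1 X u v : kpow X 1 u v = X u v.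
Proof.
rewrite /kpow /= /kmul (bigD1 v) //= eqxx mulmx1 big1 ?addr0 // => w.
by move=> /negbTE ->; rewrite mulmx0.
Qed.

Lemma kpowD X p q u v : kpow X (p + q) u v = kmul (kpow X p) (kpow X q) u v.
Proof.
elim: p u v => [|p IHp] u v; first by rewrite kpow0l.
rewrite addSn -[LHS]/(kmul X (kpow X (p + q)) u v) (eq_kmul (X' := X) (Y' := kmul (kpow X p) (kpow X q))) //.
exact: kmulA.
Qed.

End Kernels.

Section Positivity.
Local Open Scope ring_scope.
Local Open Scope sesquilinear_scope.
Variables (C : numClosedFieldType) (S T : finType) (k : nat) (A : S -> T -> 'M[C]_k).

(** The product of the adjoint of A with A. *)
Definition sqker (u v : T) : 'M[C]_k := \sum_s (A s u) ^t* *m A s v.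
Local Notation G := sqker.

Lemma sqker_adj u v : (G u v) ^t* = G v u.
Proof. by rewrite /G adj_sum; apply: eq_bigr => s _; rewrite adjM trmxCK. Qed.

Lemma kpow_adj p u v : (kpow G p u v) ^t* = kpow G p v u.
Proof.
elim: p u v => [|p IHp] u v.
  by rewrite /kpow /= eq_sym; case: eqP => _; rewrite ?trmx1 ?map_mx1 // trmx0 map_mx0.
rewrite -[in RHS]addn1 kpowD -[LHS]/((\sum_w G u w *m kpow G p w v) ^t*) adj_sum.
by apply: eq_bigr => w _; rewrite adjM IHp sqker_adj kpow1.
Qed.

Definition ktr (X : T -> T -> 'M[C]_k) := \sum_u \tr (X u u).

Lemma ktr_even p : ktr (kpow G (p + p)) = \sum_u \sum_v \tr (kpow G p u v *m (kpow G p u v) ^t*).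
Proof.
apply: eq_bigr => u _; rewrite kpowD raddf_sum; apply: eq_bigr => v _ /=.
by rewrite kpow_adj.
Qed.

(** The product of A with the p-th power of sqker. *)
Definition lker p s v : 'M[C]_k := \sum_w A s w *m kpow G p w v.

Lemma kpowS_lker p u v : kpow G p.+1 u v = \sum_s (A s u) ^t* *m lker p s v.
Proof.
rewrite -[LHS]/(\sum_w G u w *m kpow G p w v).
under eq_bigr => w _ do rewrite mulmx_suml.
rewrite exchange_big; apply: eq_bigr => s _; rewrite mulmx_sumr.
by apply: eq_bigr => w _; rewrite mulmxA.
Qed.

Lemma ktr_odd p : ktr (kpow G (p + p).+1) =
  \sum_v \sum_s \tr (lker p s v *m (lker p s v) ^t*).
Proof.
rewrite -addSn /ktr.
transitivity (\sum_u \sum_v \tr (kpow G p.+1 u v *m kpow G p v u)).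
  by apply: eq_bigr => u _; rewrite kpowD raddf_sum.
rewrite exchange_big; apply: eq_bigr => v _.
transitivity (\sum_u \sum_s \tr ((A s u) ^t* *m lker p s v *m kpow G p v u)).
  by apply: eq_bigr => u _; rewrite kpowS_lker mulmx_suml raddf_sum.
rewrite exchange_big; apply: eq_bigr => s _ /=.
rewrite {2}/lker adj_sum mulmx_sumr raddf_sum; apply: eq_bigr => u _ /=.
by rewrite adjM kpow_adj -mulmxA mxtrace_mulC mulmxA.
Qed.

Lemma sum2_eq0 (I J : finType) (F : I -> J -> 'M[C]_k) :
  \sum_i \sum_j \tr (F i j *m (F i j) ^t*) = 0 -> forall i j, F i j = 0.
Proof.
move/eqP; rewrite psumr_eq0 => [/allP h i j|i _]; last first.
  by apply: sumr_ge0 => j _; apply: mxtrace_mul_adj_ge0.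
have := h i (mem_index_enum i); rewrite /= psumr_eq0 => [/allP h'|j' _]; last first.
  exact: mxtrace_mul_adj_ge0.
by apply/mxtrace_mul_adj_eq0/eqP; apply: (h' j (mem_index_enum j)).
Qed.

(** If G^(p+2) = 0, then G^(p+1) has square G^(p+2) G^p = 0, and is zero since it is
    self-adjoint. *)
Lemma kpow_eq0 p : (forall u v, kpow G p.+1 u v = 0) -> forall s u, A s u = 0.
Proof.
elim: p => [|p IHp] h.
  suff h0 u s : A s u = 0 by move=> s u; apply: h0.
  move: u s; apply: (@sum2_eq0 _ _ (fun u s => A s u)).
  transitivity (ktr (kpow G 1)); last by rewrite /ktr big1 // => w _; rewrite h mxtrace0.
  apply: eq_bigr => w _; rewrite kpow1 raddf_sum; apply: eq_bigr => r _ /=.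
  by rewrite mxtrace_mulC.
apply: IHp; apply: sum2_eq0; rewrite -ktr_even.
(* The trace of G^(2p+2) is the squared norm of G^(p+1). *)
have -> : (p.+1 + p.+1 = p.+2 + p)%N by rewrite !addSn addnS.
rewrite /ktr big1 // => u _; rewrite kpowD /kmul big1 ?mxtrace0 // => v _.
by rewrite h mul0mx.
Qed.

Lemma ktr_gt0 p : (exists s u, A s u != 0) -> (0 < p)%N -> 0 < ktr (kpow G p).
Proof.
move=> [s0 [u0 nz]] p0; rewrite lt_neqAle eq_sym; apply/andP; split; last first.
  rewrite -(odd_double_half p) -addnn; case: (odd p); rewrite ?add0n ?add1n.
    by rewrite ktr_odd; do 2![apply: sumr_ge0 => ? _]; apply: mxtrace_mul_adj_ge0.
  by rewrite ktr_even; do 2![apply: sumr_ge0 => ? _]; apply: mxtrace_mul_adj_ge0.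
apply: contra_neq nz; rewrite -(odd_double_half p) -addnn in p0 *.
case: (odd p) p0 => /=; rewrite ?add0n ?add1n.
  rewrite ktr_odd => _ /sum2_eq0 h; apply: (@kpow_eq0 p./2) => u v.
  by rewrite kpowS_lker big1 // => s _; rewrite h mulmx0.
case: (p./2) => // q _; rewrite ktr_even => /sum2_eq0 h.
exact: (@kpow_eq0 q).
Qed.

End Positivity.

(** * Points, intervals and labels *)

(** A union of blocks of even size has even size. *)
Lemma closed_even (T : finType) (r : rel T) (G : {set T}) : is_equiv r ->
  (forall x, ~~ odd #|[set y | r x y]|) -> (forall x y, r x y -> x \in G -> y \in G) ->
  ~~ odd #|G|.
Proof.
case=> rr sr tr ev; have [k] := ubnP #|G|; elim: k G => // k IHk G lt cl.
have [->|[x xG]] := set_0Vmem G; first by rewrite cards0.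
rewrite -(cardsID [set y | r x y]) oddD negb_add eq_sym.
have -> : G :&: [set y | r x y] = [set y | r x y].
  by apply/finset.setIidPr/fintype.subsetP => y; rewrite inE => /cl; apply.
rewrite (negbTE (ev x)); have := IHk (G :\: [set y | r x y]).
case: (odd _) => //; apply.
  apply: leq_trans (_ : #|G| <= k) => //; apply: proper_card.
  rewrite properE finset.subsetDl /=; apply/fintype.subsetPn; exists x => //.
  by rewrite !inE rr.
move=> y z yz; rewrite !inE => /andP[nxy yG]; rewrite (cl y z yz yG) andbT.
by apply: contra nxy => xz; apply: tr xz _; rewrite sr.
Qed.

Lemma card_interval n a b : b <= n -> #|[set u : 'I_n | a <= u < b]| = b - a.
Proof.
elim: b => [|b IHb] bn; first by rewrite sub0n eq_card0 // => u; rewrite inE andbF.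
have [ab|ba] := leqP a b; last first.
  have /eqP -> : b.+1 - a == 0 by rewrite subn_eq0.
  rewrite eq_card0 // => u; rewrite !inE ltnS; apply/negbTE/negP => /andP[au ub].
  by move: ba; rewrite ltnNge (leq_trans au ub).
rewrite subSn // -IHb ?(ltnW bn) //.
rewrite (_ : [set u : 'I_n | a <= u < b.+1] = Ordinal bn |: [set u : 'I_n | a <= u < b]).
  by rewrite cardsU1 inE /= ltnn andbF.
apply/setP => u; rewrite !inE -val_eqE /= ltnS [u <= b]leq_eqVlt.
by have [->|_] := eqVneq (u : nat) b; rewrite ?ab //= ?ltnn.
Qed.

Lemma digit_lt (x d r : nat) : r < d -> x * d + r < x.+1 * d.
Proof. by move=> rd; rewrite mulSn addnC ltn_add2r. Qed.

Section Points.
Variables (d m : nat).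
Local Notation N := (2 * d * m)%N.
Local Notation n := (2 * m)%N.
Implicit Types (p q : 'I_N) (x y z : 'I_n) (i j : 'I_d).

(** The position of the label i (counted from 0) inside the interval x. *)
Definition offset (x i : nat) := if odd x then d.-1 - i else i.

Lemma offset_lt x i : offset x i < d.
Proof. by rewrite /offset; have := ltn_ord i; case: odd => //; ord_lia. Qed.

Lemma point_subproof x i : x * d + offset x i < N.
Proof.
apply: (@leq_trans (x.+1 * d)); first exact/digit_lt/offset_lt.
by rewrite [X in _ <= X]mulnAC leq_mul2r ltn_ord orbT.
Qed.

(** The element of label i + 1 of the interval x. *)
Definition point x i : 'I_N := Ordinal (point_subproof x i).

Lemma interval_point x i : interval_index (point x i) = x.
Proof.
have d0 : 0 < d by apply: leq_trans (ltn_ord i).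
by rewrite /interval_index /= divnMDl // divn_small ?addn0 ?offset_lt.
Qed.

Lemma label_point x i : label (point x i) = i.+1.
Proof.
rewrite /label interval_point /= modnMDl modn_small ?offset_lt // /offset.
by have := ltn_ord i; case: (odd x) => //; ord_lia.
Qed.

Lemma pointP p : exists x i, p = point x i.
Proof.
have d0 : 0 < d by rewrite lt0n; apply/eqP => d0; move: (ltn_ord p); move: (nat_of_ord p) => k; rewrite d0 muln0.
have xlt : p %/ d < n by rewrite ltn_divLR // [X in _ < X]mulnAC ltn_ord.
have ilt : offset (p %/ d) (p %% d) < d.
  by rewrite /offset; have := ltn_pmod p d0; case: odd => //; move: (p %% d) => k; clear -d0; lia.
exists (Ordinal xlt), (Ordinal ilt); apply/val_inj; rewrite /= [LHS](divn_eq p d); congr addn.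
by rewrite /offset; have := ltn_pmod p d0; case: odd => //; move: (p %% d) => k; clear -d0; lia.
Qed.

Lemma point_inj x y i j : point x i = point y j -> x = y /\ i = j.
Proof.
move=> e; split; apply/ord_inj; first by rewrite -(interval_point x i) e interval_point.
by apply: succn_inj; rewrite -(label_point x i) e label_point.
Qed.

Lemma point_lt x y i j : (point x i < point y j) =
  (x < y) || ((x == y) && (if odd x then j < i else i < j)).
Proof.
have [d0 [li lj]] : 0 < d /\ i < d /\ j < d by split=> //; apply: leq_trans (ltn_ord i).
rewrite /=; have [oi oj] := (offset_lt x i, offset_lt y j).
have [xy|yx|/ord_inj <-] := ltngtP x y.
- apply: (@leq_trans (x.+1 * d)); first exact: digit_lt.
  by apply: leq_trans (leq_addr _ _); rewrite leq_mul2r xy orbT.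
- rewrite -val_eqE /= (gtn_eqF yx) /=; apply/negbTE; rewrite -leqNgt.
  apply: (@leq_trans (y.+1 * d)); first by apply/ltnW/digit_lt.
  by apply: leq_trans (leq_addr _ _); rewrite leq_mul2r yx orbT.
- rewrite eqxx ltn_add2l /offset; case: (odd x) => //=; move: li lj; ord_lia.
Qed.

End Points.

(** * From the non-crossing partition to one relation per label *)

Section FromPartition.
Variables (d m : nat).
Local Notation N := (2 * d * m)%N.
Local Notation n := (2 * m)%N.
Implicit Types (p q c : 'I_N) (x y : 'I_n) (i j : 'I_d).

Variable P : {set {set 'I_N}}.
Hypothesis hP : NCstar P.

Let partP : finset.partition P [set: 'I_N]. Proof. by case: hP. Qed.
Let ncP : noncrossing P. Proof. by case: hP. Qed.

Lemma simE p q : sim P p q = (q \in finset.pblock P p).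
Proof.
have /and3P[/eqP cov tI _] := partP.
apply/existsP/idP => [[B /andP[BP /andP[pB qB]]]|qp]; first by rewrite (finset.def_pblock tI BP pB).
by exists (finset.pblock P p); apply/and3P; split; rewrite ?finset.pblock_mem ?finset.mem_pblock ?cov ?inE.
Qed.

Lemma sim_equiv : is_equiv (sim P).
Proof.
have /and3P[/eqP cov tI _] := partP; split.
- by move=> p; rewrite simE finset.mem_pblock cov inE.
- by move=> p q; apply/existsP/existsP => -[B /and3P[BP h1 h2]]; exists B; apply/and3P.
- move=> q p c; rewrite simE => /(finset.same_pblock tI) e; rewrite !simE e //.
Qed.

Let rS p : sim P p p. Proof. by have [h _ _] := sim_equiv. Qed.
Let sS : symmetric (sim P). Proof. by have [_ h _] := sim_equiv. Qed.
Let tS : transitive (sim P). Proof. by have [_ _ h] := sim_equiv. Qed.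

Lemma pblock_in p : finset.pblock P p \in P.
Proof. by have /and3P[/eqP cov _ _] := partP; rewrite finset.pblock_mem // cov inE. Qed.

Lemma class_even p : ~~ odd #|[set q | sim P p q]|.
Proof.
have [_ _ ev _] := hP; rewrite (_ : [set q | sim P p q] = finset.pblock P p).
  exact/ev/pblock_in.
by apply/setP => q; rewrite inE simE.
Qed.

Lemma consecutive_parity p q : sim P p q -> p < q ->
  (forall c, sim P p c -> ~~ (p < c < q)) -> odd (interval_index p) != odd (interval_index q).
Proof.
have [_ _ _ al] := hP => pq lt gap; apply: (al _ _ _ (pblock_in p)); split=> //.
- by rewrite -simE.
- by rewrite -simE.
- by move=> c; rewrite -simE; apply: gap.
Qed.

Lemma next_in_class p q : sim P p q -> p < q -> exists c,
  [/\ sim P p c, p < c <= q, forall z, sim P p z -> ~~ (p < z < c)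
    & odd (interval_index p) != odd (interval_index c)].
Proof.
move=> pq lt; pose Q c := sim P p c && (p < c).
have Qq : Q q by rewrite /Q pq lt.
have [c /andP[pc pltc] minc] := @arg_minnP _ q Q (@nat_of_ord N) Qq.
have gap z : sim P p z -> ~~ (p < z < c).
  move=> pz; apply/negP => /andP[h1 h2]; have := minc z; rewrite /Q pz h1 => /(_ isT).
  by rewrite leqNgt h2.
by exists c; split=> //; [rewrite pltc minc|apply: consecutive_parity].
Qed.

Lemma prev_in_class p q : sim P p q -> p < q -> exists c,
  [/\ sim P p c, p <= c < q, forall z, sim P p z -> ~~ (c < z < q)
    & odd (interval_index c) != odd (interval_index q)].
Proof.
move=> pq lt; pose Q c := sim P p c && (c < q).
have Qp : Q p by rewrite /Q rS lt.
have [c /andP[pc cltq] maxc] := @arg_maxnP _ p Q (@nat_of_ord N) Qp.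
have gap z : sim P p z -> ~~ (c < z < q).
  move=> pz; apply/negP => /andP[h1 h2]; have := maxc z; rewrite /Q pz h2 => /(_ isT).
  by rewrite /geq /= leqNgt h1.
exists c; split=> //; first by rewrite cltq andbT; apply: maxc.
apply: consecutive_parity => //; first by apply: tS pq; rewrite sS.
by move=> z cz; apply: gap; apply: tS cz.
Qed.

(** The parity of the interval changes at each step along a block. *)
Lemma rank_parity q0 p : (forall z, sim P q0 z -> q0 <= z) -> sim P q0 p ->
  odd #|[set z | sim P q0 z && (z < p)]| =
  odd (interval_index p) (+) odd (interval_index q0).
Proof.
move=> min0; have [k] := ubnP (nat_of_ord p); elim: k p => // k IHk p pk q0p.
have := min0 _ q0p; rewrite leq_eqVlt => /orP[/eqP/ord_inj <-|lt].
  rewrite addbb eq_card0 // => z; rewrite inE; apply/negbTE/negP => /andP[/min0].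
  by rewrite leqNgt => /negbTE ->.
have [c [q0c /andP[_ cp] gap par]] := prev_in_class q0p lt.
have -> : [set z | sim P q0 z && (z < p)] = c |: [set z | sim P q0 z && (z < c)].
  apply/setP => z; rewrite !inE; case: (ltngtP z c) => [zc|cz|/ord_inj ->].
  - rewrite (ltn_trans zc cp) -val_eqE /= (ltn_eqF zc) //.
  - rewrite -val_eqE /= (gtn_eqF cz) andbF /=; apply/negbTE/negP => /andP[q0z zp].
    by have := gap z q0z; rewrite cz zp.
  - by rewrite eqxx q0c cp.
rewrite cardsU1 inE ltnn andbF /= IHk //; last by apply: leq_trans cp _.
by move: par; case: (odd _); case: (odd _); case: (odd _).
Qed.

Lemma min_max_parity q0 p : (forall z, sim P q0 z -> q0 <= z) -> sim P q0 p ->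
  (forall z, sim P q0 z -> z <= p) -> odd (interval_index p) != odd (interval_index q0).
Proof.
move=> min0 q0p maxp; have := class_even q0.
have -> : [set z | sim P q0 z] = p |: [set z | sim P q0 z && (z < p)].
  apply/setP => z; rewrite !inE; have [->|zp] := eqVneq z p; first by rewrite q0p.
  case q0z: (sim P q0 z) => //=; by rewrite ltn_neqAle val_eqE zp maxp.
rewrite cardsU1 inE ltnn andbF /= rank_parity //.
by case: (odd _); case: (odd _).
Qed.

Lemma noncrossing_gap p q c z : sim P p q -> p < c < q ->
  (forall u, sim P p u -> ~~ (p < u < q)) -> sim P c z -> p < z < q.
Proof.
move=> pq /andP[pc cq] gap cz.
have npc : ~~ sim P p c by apply/negP => /gap; rewrite pc cq.
have npz : ~~ sim P p z by apply: contra npc => pz; apply: tS pz _; rewrite sS.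
rewrite !ltnNge; apply/andP; split; apply/negP.
  rewrite leq_eqVlt => /orP[/eqP/ord_inj zp|zp]; first by rewrite zp rS in npz.
  have := ncP zp pc cq; rewrite sS cz => /(_ isT pq) h.
  by move: npz; rewrite sS h.
rewrite leq_eqVlt => /orP[/eqP/ord_inj qz|qz]; first by rewrite -qz pq in npz.
by have := ncP pc cq qz pq cz; apply/negP.
Qed.

(** If i and j differ, the points of one of these two labels strictly between
    the point of label i in x and the point of label j in y are those of an odd number
    of consecutive intervals: the label counted is present next to exactly one of the
    two ends. *)
Lemma label_gap x y i j : odd x != odd y -> x < y -> i != j -> exists (l : 'I_d) u v,
  [/\ u <= v, v <= n, odd (v - u)
    & forall z : 'I_n, (point x i < point z l < point y j) = (u <= z < v)].
Proof.
move=> oxy xy ij.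
have lt_l (z : 'I_n) (l : 'I_d) : (point x i < point z l) =
    if (if odd x then l < i else i < l) then x <= z else x < z.
  rewrite point_lt; case: (if odd x then l < i else i < l); rewrite ?andbF ?orbF // andbT.
  by rewrite [x <= z]leq_eqVlt (inj_eq (@ord_inj _)) orbC.
have lt_r (z : 'I_n) (l : 'I_d) : (point z l < point y j) =
    if (if odd y then j < l else l < j) then z <= y else z < y.
  rewrite point_lt; have [->|zy] := eqVneq z y.
    by case: (if odd y then j < l else l < j); rewrite ltnn ?leqnn.
  rewrite orbF; case: (if odd y then j < l else l < j) => //.
  by rewrite [z <= y]leq_eqVlt (inj_eq (@ord_inj _)) (negbTE zy).
have odd1 : odd (y - x) by rewrite oddB ?(ltnW xy) //; case: (odd x) oxy; case: (odd y).
have yn := ltn_ord y; have yn' := ltnW yn; have xy' := ltnW xy.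
have sub1 : y.+1 - x.+1 = y - x by rewrite subSS.
have /orP[h|h] : (i < j) || (j < i) by rewrite -neq_ltn.
  case ox: (odd x) oxy lt_l lt_r; case oy: (odd y) => // _ lt_l lt_r.
    by exists i, x.+1, y.+1; rewrite sub1; split=> // z; rewrite lt_l lt_r ltnn h.
  by exists j, x, y; split=> // z; rewrite lt_l lt_r ltnn h.
case ox: (odd x) oxy lt_l lt_r; case oy: (odd y) => // _ lt_l lt_r.
  by exists j, x, y; split=> // z; rewrite lt_l lt_r ltnn h.
by exists i, x.+1, y.+1; rewrite sub1; split=> // z; rewrite lt_l lt_r ltnn h.
Qed.

(** Equality of labels propagates along a block from consecutive elements. *)
Lemma sim_label_chain k p q : q - p < k -> sim P p q -> p < q ->
  (forall p q, sim P p q -> p < q -> q - p < k ->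
     (forall c, sim P p c -> ~~ (p < c < q)) -> label p = label q) -> label p = label q.
Proof.
move=> qpk pq lt H; have [t] := ubnP (q - p); elim: t p qpk pq lt => // t IHt p qpk pq lt qpt.
have [c [pc /andP[ltpc leqcq] gap _]] := next_in_class pq lt.
have cqk : c - p < k by apply: leq_ltn_trans qpk; apply: leq_sub2r.
rewrite (H _ _ pc ltpc cqk gap).
move: leqcq; rewrite leq_eqVlt => /orP[/eqP/ord_inj -> //|ltcq].
have lt2 : q - c < q - p by apply: ltn_sub2l.
apply: IHt => //; first exact: ltn_trans qpk.
  by apply: tS pq; rewrite sS.
by apply: leq_trans lt2 _.
Qed.

(** Induction on the distance.  The gap between two consecutive elements of a block is
    a union of blocks, which by induction have constant labels; so it contains an even
    number of points of each label, and label_gap applies. *)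
Lemma sim_label_consecutive k p q : sim P p q -> p < q -> q - p < k ->
  (forall c, sim P p c -> ~~ (p < c < q)) -> label p = label q.
Proof.
elim: k p q => // k IHk p q pq lt qpk gap.
have near c z : sim P c z -> p < c < q -> label c = label z.
  move=> cz pcq; have /andP[pz zq] := noncrossing_gap pq pcq gap cz.
  have /andP[pc cq] := pcq; have lk u v : p < u -> v < q -> u < v -> v - u < k.
    by move=> h1 h2 h3; move: qpk h1 h2 h3; ord_lia.
  have [ltcz|ltzc|e] := ltngtP c z.
  - by apply: (@sim_label_chain k) => //; exact: lk.
  - by apply/esym; apply: (@sim_label_chain k) => //; [exact: lk|rewrite sS].
  - by congr label; apply/ord_inj.
have par := consecutive_parity pq lt gap.
have [x [i pE]] := pointP p; have [y [j qE]] := pointP q.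
rewrite pE qE !label_point; have [-> //|ij] := eqVneq i j.
have xy : x < y.
  move: lt par; rewrite pE qE point_lt !interval_point => /orP[//|/andP[/eqP -> _]].
  by rewrite eqxx.
rewrite pE qE !interval_point in par.
have [l [u [v [uv vn odvu zE]]]] := label_gap par xy ij.
(* G is a union of blocks, but it has odd size by the choice of l. *)
pose G := [set c : 'I_N | (label c == l.+1) && (p < c < q)].
have : ~~ odd #|G|.
  apply: (closed_even sim_equiv) => [c|c z cz]; first exact: class_even.
  rewrite !inE => /andP[/eqP lc pcq]; rewrite -(near _ _ cz pcq) lc eqxx /=.
  exact: noncrossing_gap cz.
have -> : G = (fun z => point z l) @: [set z : 'I_n | u <= z < v].
  apply/setP => c; apply/idP/imsetP.
    rewrite inE => /andP[/eqP lc pcq]; have [z [l' cE]] := pointP c.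
    have ll : l' = l by apply/ord_inj/succn_inj; rewrite -lc cE label_point.
    by exists z; rewrite ?cE ?ll // inE -zE -pE -qE -ll -cE.
  by move=> [z]; rewrite !inE => zuv ->; rewrite label_point eqxx pE qE zE.
rewrite card_imset; last by move=> z z' /point_inj[].
by rewrite card_interval // odvu.
Qed.

Lemma sim_label p q : sim P p q -> label p = label q.
Proof.
move=> pq; have key p' q' : sim P p' q' -> p' < q' -> label p' = label q'.
  move=> h1 h2; apply: (@sim_label_chain (q' - p').+1) => // u v uv lt _ gap.
  exact: (@sim_label_consecutive (v - u).+1).
have [lt|gt|e] := ltngtP p q; [exact: key|by apply/esym/key; rewrite // sS|].
by congr label; apply/ord_inj.
Qed.

(** The restriction of P to the label i + 1, as a relation between intervals. *)
Definition labelled i : rel 'I_n := fun x y => sim P (point x i) (point y i).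

Lemma labelled_equiv i : is_equiv (labelled i).
Proof. by split=> [x|x y|y x z]; rewrite /labelled //; apply: tS. Qed.

Lemma sim_point x i q : sim P (point x i) q -> exists2 y, q = point y i & labelled i x y.
Proof.
move=> xq; have [y [j qE]] := pointP q; rewrite qE in xq *.
have := sim_label xq; rewrite !label_point => /succn_inj/ord_inj ij.
by subst j; exists y.
Qed.

Lemma point_ltE x y i : (point x i < point y i) = (x < y).
Proof. by rewrite point_lt; case: (odd x); rewrite ltnn andbF orbF. Qed.

Lemma labelled_noncrossing i x y z t : labelled i x z -> labelled i y t ->
  x < y -> y < z -> z < t -> labelled i x y.
Proof. by move=> xz yt xy yz zt; apply: (ncP _ _ _ xz yt); rewrite point_ltE. Qed.

Lemma labelled_even i x : ~~ odd #|[set y | labelled i x y]|.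
Proof.
have := class_even (point x i).
have -> : [set q | sim P (point x i) q] = (fun y => point y i) @: [set y | labelled i x y].
  apply/setP => q; rewrite inE; apply/idP/imsetP => [/sim_point[y -> xy]|[y]].
    by exists y; rewrite ?inE.
  by rewrite inE => xy ->.
by rewrite card_imset // => y y' /point_inj[].
Qed.

Lemma labelled_alternating i : alternating (labelled i).
Proof.
move=> x y xy oxy.
have [le|lt] := leqP y x; last first.
  have ltp : point x i < point y i by rewrite point_ltE.
  have [c [xc /andP[ltxc lecy] _ par]] := next_in_class xy ltp.
  have [z cE xz] := sim_point xc; rewrite {}cE !interval_point in xc ltxc lecy par.
  exists z; split=> //; first by rewrite eq_sym.
  rewrite /btw -(point_ltE x z i) ltxc /= ltn_neqAle; apply/orP; left.
  rewrite leqNgt -(point_ltE y z i) -leqNgt lecy andbT; apply/eqP => /ord_inj zy.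
  by move: par; rewrite oxy zy eqxx.
have [rE sE tE] := labelled_equiv i.
have [/existsP[z /andP[xz ltxz]]|nox] := boolP [exists z, labelled i x z && (x < z)].
  have ltp : point x i < point z i by rewrite point_ltE.
  have [c [xc /andP[ltxc _] _ par]] := next_in_class xz ltp.
  have [t cE xt] := sim_point xc; rewrite {}cE !interval_point in xc ltxc par.
  exists t; split=> //; first by rewrite eq_sym.
  by rewrite /btw le -(point_ltE x t i) ltxc orbT.
have [/existsP[z /andP[yz ltzy]]|noy] := boolP [exists z, labelled i y z && (z < y)].
  have ltp : point z i < point y i by rewrite point_ltE.
  have zy : sim P (point z i) (point y i) by rewrite sS.
  have [c [zc /andP[_ ltcy] _ par]] := prev_in_class zy ltp.
  have [t cE zt] := sim_point zc; rewrite {}cE !interval_point in zc ltcy par.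
  exists t; split; first exact: (tE _ _ _ xy (tE _ _ _ yz zt)).
    by rewrite oxy.
  by rewrite /btw le -(point_ltE t y i) ltcy !orbT.
have : odd (interval_index (point x i)) != odd (interval_index (point y i)).
  apply: min_max_parity; last 1 first.
  - move=> q /sim_point[z -> yz]; rewrite leqNgt point_ltE; apply: contra nox => xz.
    by apply/existsP; exists z; rewrite xz (tE _ _ _ xy yz).
  - move=> q /sim_point[z -> yz]; rewrite leqNgt point_ltE; apply: contra noy => zy.
    by apply/existsP; exists z; rewrite zy yz.
  - by rewrite sS.
by rewrite !interval_point oxy eqxx.
Qed.

Lemma sim_uncrossed (x x' y y' : 'I_N) : sim P x x' -> sim P y y' -> ~~ sim P x y ->
  (x < y) (+) (x' < y) (+) ((x < y') (+) (x' < y')) = false.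
Proof.
move=> xx yy nxy.
have nxy' : ~~ sim P x y' by apply: contra nxy => h; apply: tS h _; rewrite sS.
have nx'y : ~~ sim P x' y by apply: contra nxy; apply: tS.
have nx'y' : ~~ sim P x' y' by apply: contra nxy'; apply: tS.
have x'x : sim P x' x by rewrite sS.
have y'y : sim P y' y by rewrite sS.
have nc (a b c e : 'I_N) : a < b -> b < c -> c < e -> sim P a c -> sim P b e -> ~~ sim P a b -> False.
  by move=> h1 h2 h3 ac be /negP; apply; apply: (ncP _ _ _ ac be).
have nc' (a b c e : 'I_N) : a < b -> b < c -> c < e -> sim P a c -> sim P b e -> ~~ sim P b a -> False.
  by move=> h1 h2 h3 ac be; rewrite sS; apply: (nc a b c e).
have neq (u v : 'I_N) : ~~ sim P u v -> u = v :> nat -> False.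
  by move=> nuv /ord_inj uv; rewrite uv rS in nuv.
have [a1|a1|/(neq _ _ nxy)//] := ltngtP x y; have [a2|a2|/(neq _ _ nx'y)//] := ltngtP x' y;
have [a3|a3|/(neq _ _ nxy')//] := ltngtP x y'; have [a4|a4|/(neq _ _ nx'y')//] := ltngtP x' y' => //;
exfalso.
all: first [exact: (nc x y x' y')|exact: (nc x y' x' y)|exact: (nc x' y x y')|exact: (nc x' y' x y)
  |exact: (nc' y x y' x')|exact: (nc' y x' y' x)|exact: (nc' y' x y x')|exact: (nc' y' x' y x)].
Qed.

Lemma labelled_uncrossed i j : i < j -> uncrossed false (labelled i) (labelled j).
Proof.
move=> ij x x' y y' xx yy.
have aE (u v : 'I_n) : after false v u = (point u i < point v j).
  rewrite point_lt /after; case: (u =P v) => [->|_] //=.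
  by rewrite (ltnNge j i) (ltnW ij) ij; case: (odd v).
rewrite !aE; apply: sim_uncrossed => //.
by apply/negP => /sim_label; rewrite !label_point => /succn_inj e; rewrite e ltnn in ij.
Qed.

Lemma sim_restr i x y : sim (restr P i.+1) x y = labelled i x y.
Proof.
apply/existsP/idP => [[B /andP[]]|/existsP[B /and3P[BP xB yB]]].
  rewrite inE => /andP[_ /imsetP[A AP ->]]; rewrite !inE.
  case/andP => /existsP[p /andP[]] + /eqP px /existsP[q /andP[]] + /eqP qy.
  rewrite !inE => /andP[pA /eqP lp] /andP[qA /eqP lq].
  have lE (u : 'I_N) (z : 'I_n) : label u = i.+1 -> interval_index u = z -> u = point z i.
    move=> lu iu; have [z' [i' uE]] := pointP u; move: lu iu.
    by rewrite uE label_point interval_point => /succn_inj/ord_inj -> /ord_inj ->.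
  by apply/existsP; exists A; rewrite AP -(lE p x) // -(lE q y) // pA qA.
have mem z : point z i \in B ->
    z \in [set k : 'I_n | [exists p in B :&: A_ d m i.+1, interval_index p == k]].
  move=> zB; rewrite inE; apply/existsP; exists (point z i).
  by rewrite !inE zB label_point interval_point !eqxx.
exists [set k : 'I_n | [exists p in B :&: A_ d m i.+1, interval_index p == k]].
rewrite !mem // !andbT !inE; apply/andP; split; last by apply/imsetP; exists B.
by apply/finset.set0Pn; exists x; apply: mem.
Qed.

End FromPartition.

Section Count.
Variable m : nat.
Local Notation n := (2 * m)%N.

Lemma card_equivalence_partition (r : rel 'I_m) : is_equiv r ->
  #|equivalence_partition r [set: 'I_m]| = \sum_(k : 'I_m) [forall l : 'I_m, (l < k) ==> ~~ r l k].
Proof.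
move=> [rr sr tr].
pose F (k : 'I_m) := [set y in [set: 'I_m] | r k y].
pose M := [set k : 'I_m | [forall l : 'I_m, (l < k) ==> ~~ r l k]].
have FE k l : r k l -> F k = F l.
  move=> kl; apply/setP => y; rewrite !inE /=; apply/idP/idP; last exact: tr.
  by apply: tr; rewrite sr.
have -> : equivalence_partition r [set: 'I_m] = F @: M.
  apply/setP => A; apply/imsetP/imsetP => [[k _ ->]|[k _ ->]]; last by exists k.
  have [l kl lmin] := @arg_minnP _ k (r k) (@nat_of_ord m) (rr k).
  exists l; last by rewrite -/(F k) (FE k l).
  rewrite inE; apply/forallP => l'; apply/implyP => ll'; apply/negP => h.
  by have := lmin l' (tr _ _ _ kl (_ : r l l')); rewrite sr leqNgt ll' => /(_ h).
rewrite card_in_imset => [|k l]; last first.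
  rewrite !inE => /forallP hk /forallP hl /setP/(_ l); rewrite !inE /= rr => kl.
  apply/ord_inj; have [lt|lt|//] := ltngtP k l.
    by have := hl k; rewrite lt kl.
  by have := hk l; rewrite lt sr kl.
rewrite -sum1_card big_mkcond; apply: eq_bigr => k _; rewrite inE.
by case: [forall _, _].
Qed.

Variable r : rel 'I_n.
Hypothesis er : is_equiv r.
Hypothesis r_even : forall x, ~~ odd #|[set y | r x y]|.
Hypothesis r_nc : forall x y z t : 'I_n, r x z -> r y t -> x < y -> y < z -> z < t -> r x y.
Let rr x : r x x. Proof. by have [h _ _] := er. Qed.
Let sr : symmetric r. Proof. by have [_ h _] := er. Qed.
Let tr : transitive r. Proof. by have [_ _ h] := er. Qed.

(** If a is even and the minimum of its block, then a is the left end of a segment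
    [a, b) with b even that is a union of blocks: b is the first element after a that
    is related to an element before a, if there is one, and the end of the cycle
    otherwise.  In particular nothing in this segment is connected to the left of a,
    even after identifying 2j with 2j + 1. *)
Lemma closed_segment (a : 'I_n) : ~~ odd a -> block_min r a -> exists b,
  [/\ a < b <= n, ~~ odd b & forall u v, r u v -> a <= u < b -> a <= v < b].
Proof.
move=> odda /block_minP amin.
pose Q (y : 'I_n) := (a < y) && [exists w : 'I_n, (w < a) && r w y].
have segQ (u v : 'I_n) : r u v -> a <= u -> v < a -> Q u.
  move=> uv; rewrite leq_eqVlt => /orP[/eqP/ord_inj au|au] va; last first.
    by rewrite /Q au; apply/existsP; exists v; rewrite va sr.
  rewrite -au sr in uv; by have := amin v uv; rewrite leqNgt va.
suff [b [ab bn cl]] : exists b, [/\ a < b, b <= n & forall u v, r u v -> a <= u < b -> a <= v < b].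
  exists b; rewrite ab bn; split=> //.
  have := @closed_even _ r [set u : 'I_n | a <= u < b] er r_even.
  rewrite card_interval // oddB ?(ltnW ab) // (negbTE odda) addbF; apply.
  by move=> u v uv; rewrite !inE; apply: cl.
have [y0 Qy0|noQ] := pickP Q; last first.
  exists n; split=> // u v uv /andP[au _]; rewrite ltn_ord andbT leqNgt.
  by apply/negP => /(segQ _ _ uv au); rewrite noQ.
have [b Qb minb] := @arg_minnP _ y0 Q (@nat_of_ord n) Qy0.
have /andP[ab /existsP[w /andP[wa wb]]] := Qb.
exists b; split=> //; first exact: ltnW.
move=> u v uv /andP[au ub].
have nQ : ~~ Q u by apply/negP => /minb; rewrite leqNgt ub.
rewrite leqNgt; apply/andP; split; first by apply: contra nQ; apply: segQ uv au.
rewrite ltnNge leq_eqVlt; apply/negP => /orP[/eqP/ord_inj bv|bv].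
  by case/negP: nQ; apply: (segQ u w) => //; apply: tr uv _; rewrite -bv sr.
case/negP: nQ; apply: (segQ u w) => //; rewrite sr.
exact: (r_nc wb uv (leq_trans wa au) ub bv).
Qed.

Variable rho : {set {set 'I_n}}.
Hypothesis rhoE : forall x y, sim rho x y = r x y.

Lemma Phi_sym : symmetric (Phi_rel rho).
Proof.
by move=> k l; apply/existsP/existsP => -[x /existsP[y /and3P[h1 h2 h3]]]; exists y;
  apply/existsP; exists x; rewrite h1 h2 rhoE sr -rhoE.
Qed.

(** A block of Phi is counted at its minimum j, and j is such a minimum if and only if
    2j is the minimum of its block for rho. *)
Lemma Bnum_nb_open : Bnum rho = nb_open false r.
Proof.
have csym : connect_sym (Phi_rel rho) by apply: sym_connect_sym; apply: Phi_sym.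
have ceq : is_equiv (connect (Phi_rel rho)).
  by split=> [k|//|l k t]; [apply: connect0|apply: connect_trans].
rewrite /Bnum /Phi card_equivalence_partition // /nb_open addn0 big_pairs.
apply: eq_bigr => k _; rewrite odE /= !oddM /= addn0; congr nat_of_bool.
apply/forallP/idP => [h|mink l].
  apply/block_minP => y yk; rewrite leqNgt; apply/negP => ltyk.
  have := h (pair_index y); rewrite pair_indexE.
  have -> : y./2 < k by move: ltyk => /=; ord_lia.
  rewrite connect1 //; apply/existsP; exists y; apply/existsP; exists (ev k).
  by rewrite rhoE yk pair_indexE eqxx andbT /=; apply/eqP; ord_lia.
apply/implyP => lk; have oddk : ~~ odd (ev k) by rewrite /= oddM.
have [b [/andP[kb bn] oddb cl]] := closed_segment oddk mink.
pose W := [pred l : 'I_m | k <= l < b./2].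
have inW (x : 'I_n) (j : 'I_m) : x./2 == j -> (j \in W) = (ev k <= x < b).
  by rewrite inE /= => /eqP <-; move: oddb; ord_lia.
have Wcl : closed (Phi_rel rho) W.
  move=> j j' /existsP[x /existsP[y /and3P[xj yj]]]; rewrite rhoE => xy.
  rewrite (inW _ _ xj) (inW _ _ yj); apply/idP/idP; apply: cl => //.
  by rewrite sr.
apply/negP => /(closed_connect Wcl); rewrite !inE (leqNgt k) lk leqnn /=.
by move=> /esym/negbT/negP; apply; move: kb oddb => /=; ord_lia.
Qed.

End Count.

(** * Reduction to finite sums *)

Section Finite.
Local Open Scope ring_scope.
Local Open Scope sesquilinear_scope.

Lemma prod_factor0 (R : pzRingType) (I : eqType) (s : seq I) (F : I -> R) j :
  j \in s -> F j = 0 -> \prod_(i <- s) F i = 0.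
Proof.
elim: s => // i s IHs; rewrite inE big_cons => /orP[/eqP <- ->|js Fj]; first by rewrite mul0r.
by rewrite IHs // mulr0.
Qed.

(** A sum over the support reduces to a sum over a finite type whose image under h
    contains that support. *)
Lemma fsbig_inj (V : nmodType) (I : finType) (T : choiceType) (h : I -> T) (D : set T)
    (p : pred I) (f : T -> V) : injective h -> (forall i, p i <-> D (h i)) ->
  (forall t, D t -> f t <> 0 -> exists i, t = h i) ->
  \sum_(t \in D) f t = \sum_(i | p i) f (h i).
Proof.
move=> hi pD sup; pose s := [seq h i | i <- enum I & p i].
have us : uniq s by rewrite map_inj_uniq // filter_uniq // enum_uniq.
transitivity (\sum_(t \in [set` s]%classic) f t).
  apply/esym/fsbig_widen => t.
    by move=> /= /mapP[j]; rewrite mem_filter => /andP[/pD Di _] ->.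
  move=> [Dt /= ns]; apply: contrapT => /(sup _ Dt) [i ti]; apply: ns.
  by rewrite ti map_f // mem_filter mem_enum andbT; apply/pD; rewrite -ti.
rewrite -fsbig_seq // big_map big_filter big_enum_cond /=.
by apply: eq_bigl => i; rewrite ?inE.
Qed.

Variables (C : numClosedFieldType) (alpha d K : nat).
Variable a : d.-tuple nat -> 'M[C]_alpha.
Hypothesis aK : forall k, a k <> 0 -> forall i, (tnth k i < K)%N.
Notation U := 'I_K.

(** Multi-indices with entries below the bound K of the support, as tuples. *)
Definition emb p (v : {ffun 'I_p -> U}) : p.-tuple nat := [tuple v i : nat | i < p].

Lemma tnth_emb p (v : {ffun 'I_p -> U}) i : tnth (emb v) i = v i.
Proof. by rewrite tnth_mktuple. Qed.

Lemma emb_inj p : injective (@emb p).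
Proof.
move=> u v e; apply/ffunP => i; apply/ord_inj.
by rewrite -tnth_emb e tnth_emb.
Qed.

Lemma embP p (k : p.-tuple nat) : (forall i, (tnth k i < K)%N) -> exists v, k = emb v.
Proof.
move=> h; exists [ffun i => Ordinal (h i)]; apply/eq_from_tnth => i.
by rewrite tnth_emb ffunE.
Qed.

Definition afin (v : {ffun 'I_d -> U}) := a (emb v).

Section Words.
Local Open Scope ring_scope.
Local Open Scope sesquilinear_scope.
Variable m : nat.
Notation n := (2 * m)%N.
Notation N := (2 * d * m)%N.

(** In the sum S the indices of the intervals where labels decrease are read
    backwards, which cancels the reversal in atilde. *)
Definition embword (k : {ffun 'I_n -> {ffun 'I_d -> U}}) : n.-tuple (d.-tuple nat) :=
  [tuple if odd x then [tuple of rev (emb (k x))] else emb (k x) | x < n].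

Lemma rev_tupleK p (T : Type) (t : p.-tuple T) : [tuple of rev [tuple of rev t]] = t.
Proof. by apply/val_inj; rewrite /= revK. Qed.

Lemma embword_inj : injective embword.
Proof.
move=> k k' e; apply/ffunP => x; apply: emb_inj.
have := congr1 (fun t => tnth t x) e; rewrite !tnth_mktuple; case: (odd x) => //.
by move=> h; rewrite -[LHS]rev_tupleK h rev_tupleK.
Qed.

Lemma nth_flatten_uniform (T : eqType) (x0 : T) (ss : seq (seq T)) x r :
  (forall s, s \in ss -> size s = d) -> (r < d)%N ->
  nth x0 (flatten ss) (x * d + r) = nth x0 (nth [::] ss x) r.
Proof.
elim: ss x => [|s ss IHss] x hs rd; first by rewrite !nth_nil.
have sd : size s = d by apply: hs; rewrite mem_head.
rewrite /= nth_cat sd; case: x => [|x]; first by rewrite mul0n add0n rd.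
rewrite mulSn -addnA ltnNge leq_addr /= addKn; apply: IHss => // t ts.
by apply: hs; rewrite inE ts orbT.
Qed.

Lemma nth_embword k (x : 'I_n) (i : 'I_d) :
  nth 0%N (flatten [seq val t | t <- embword k]) (point x i) = k x i.
Proof.
rewrite nth_flatten_uniform ?offset_lt //; last first.
  by move=> s /mapP[t _ ->]; rewrite size_tuple.
rewrite (nth_map (tnth (embword k) x)) ?size_tuple // -tnth_nth tnth_mktuple /offset.
case: (odd x); last by rewrite -(tnth_nth 0%N (emb (k x)) i) tnth_emb.
rewrite -[tval _]/(rev (emb (k x))) nth_rev; last by rewrite size_tuple; have := ltn_ord i; ord_lia.
rewrite size_tuple.
have -> : (d - (d.-1 - i).+1 = i)%N by have := ltn_ord i; ord_lia.
by rewrite -(tnth_nth 0%N (emb (k x)) i) tnth_emb.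
Qed.

Variable P : {set {set 'I_N}}.
Hypothesis hP : NCstar P.

Lemma compat_embword k : compatible (labelled P) k <-> compat (embword k) P.
Proof.
split=> [/compatibleP h kk p q pq|h].
  have [x [i pE]] := pointP p; rewrite pE in pq *.
  have [y -> xy] := sim_point hP pq.
  by rewrite /kk !nth_embword (h i x y).
apply/compatibleP => i x y xy; apply/ord_inj; rewrite -!nth_embword.
exact: h.
Qed.

Lemma S_wordsum : S_ a P = wordsum afin false (labelled P).
Proof.
rewrite /S_.
rewrite (fsbig_inj (p := compatible (labelled P)) embword_inj); last 2 first.
- exact: compat_embword.
- move=> k _ nz.
  pose t j := if odd (nat_of_ord j) then [tuple of rev (tnth k j)] else tnth k j.
  have tK j : exists v, t j = emb v.
    apply/embP/aK => aj0; apply: nz.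
    rewrite (prod_factor0 (j := j)) ?mxtrace0 ?mem_index_enum //.
    by move: aj0; rewrite /t /atilde; case: (odd j) => [->|//]; rewrite trmx0 map_mx0.
  have [g gE] := choice tK; exists [ffun j => g j].
  apply/eq_from_tnth => j; rewrite tnth_mktuple ffunE -gE /t.
  by case: (odd j); rewrite ?rev_tupleK.
apply: eq_bigr => k _; congr (\tr _); apply: eq_bigr => j _.
rewrite tnth_mktuple /letter addbF /atilde /afin; case: (odd j) => //.
by rewrite rev_tupleK.
Qed.

End Words.
Section Powers.
Local Open Scope ring_scope.
Local Open Scope sesquilinear_scope.
Variable l : 'I_d.+1.
Notation Vl := {ffun 'I_l -> U}.
Notation Vr := {ffun 'I_(d - l) -> U}.

Lemma M_emb (s : Vl) (t : Vr) : M_ a l (emb s) (emb t) = afin (mix s t).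
Proof.
congr a; apply/eq_from_tnth => i; rewrite tnth_emb tcastE (tnth_nth 0%N) nth_cat size_tuple.
rewrite ffunE; case: (fintype.splitP (cast_ord (mix_subproof l) i)) => j /= ->.
  by rewrite -[RHS]tnth_emb (tnth_nth 0%N).
by rewrite addKn -[RHS]tnth_emb (tnth_nth 0%N).
Qed.

Lemma M_out s t : M_ a l s t <> 0 -> (exists v : Vl, s = emb v) /\ (exists u : Vr, t = emb u).
Proof.
move/aK => h; split; apply: embP => j.
  have := h (cast_ord (subnKC (leq_ord l)) (lshift _ j)).
  by rewrite tcastE cast_ordK tnth_lshift.
have := h (cast_ord (subnKC (leq_ord l)) (rshift _ j)).
by rewrite tcastE cast_ordK tnth_rshift.
Qed.

(** The product of the adjoint of M_l with M_l; it vanishes outside the image of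
    emb. *)
Definition MstarM := bmul (badj (M_ a l)) (M_ a l).

Lemma MstarM_emb (t t' : Vr) : MstarM (emb t) (emb t') = gram afin t t'.
Proof.
rewrite /MstarM /bmul (fsbig_inj (p := predT) (@emb_inj l)) // => [|s _ nz].
  by apply: eq_bigr => s _; rewrite /badj !M_emb.
suff /M_out[] : M_ a l s (emb t') <> 0 by [].
by move=> z; apply: nz; rewrite z mulmx0.
Qed.

Lemma MstarM_out t t' : MstarM t t' <> 0 -> (exists u : Vr, t = emb u) /\ (exists u : Vr, t' = emb u).
Proof.
move=> nz; split; apply: contrapT => nu; apply: nz; apply: fsbig1 => s _.
  rewrite /badj; suff -> : M_ a l s t = 0 by rewrite trmx0 map_mx0 mul0mx.
  by apply: contrapT => /M_out[].
suff -> : M_ a l s t' = 0 by rewrite mulmx0.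
by apply: contrapT => /M_out[].
Qed.

Lemma bexp_emb p (t t' : Vr) : bexp MstarM p (emb t) (emb t') = kpow (gram afin (l := l)) p t t'.
Proof.
elim: p t t' => [|p IHp] t t'; first by rewrite /bexp /= /bid (inj_eq (@emb_inj _)).
rewrite -[LHS]/(bmul MstarM (bexp MstarM p) _ _) /bmul.
rewrite (fsbig_inj (p := predT) (@emb_inj (d - l))) // => [|s _ nz].
  by apply: eq_bigr => s _; rewrite MstarM_emb IHp.
suff /MstarM_out[_] : MstarM (emb t) s <> 0 by [].
by move=> z; apply: nz; rewrite z mul0mx.
Qed.

Lemma btr_bexp p : btr (bexp MstarM p.+1) = ktr (kpow (gram afin (l := l)) p.+1).
Proof.
rewrite /btr (fsbig_inj (p := predT) (@emb_inj (d - l))) // => [|s _ nz].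
  by apply: eq_bigr => s _; rewrite bexp_emb.
apply: contrapT => ns; apply: nz; rewrite -[bexp _ _]/(bmul MstarM (bexp MstarM p)) /bmul.
rewrite fsbig1 ?mxtrace0 // => t _; suff -> : MstarM s t = 0 by rewrite mul0mx.
by apply: contrapT => /MstarM_out[].
Qed.

End Powers.
End Finite.

(** * Exponents and conclusion *)

Section Bound.
Local Open Scope ring_scope.
Local Open Scope sesquilinear_scope.
Variables (R : realType) (d m : nat).
Hypothesis m_gt1 : (1 < m)%N.
Variable r : 'I_d.+1 -> R.
Hypothesis r_gt0 : forall l, 0 < r l.
Implicit Types w : {ffun 'I_d -> nat}.

(** The sequence 1, w 0, ..., w (d - 1), m of the numbers B of the labels completed by
    the two conventions at its ends. *)
Definition profile w (l : nat) : nat :=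
  if l is j.+1 then (if insub j is Some i then w i else m) else 1%N.

Definition slope w (l : nat) : R := ((profile w l.+1)%:R - (profile w l)%:R) / (m%:R - 1).

(** The right-hand side of the theorem as a function of the numbers of blocks, where
    r l stands for the 2m-th power of the Schatten norm of M_l. *)
Definition interpolation w : R := \prod_(l < d.+1) r l `^ slope w l.

Lemma interpolation_gt0 w : 0 < interpolation w.
Proof. by apply: prodr_gt0 => l _; apply: powR_gt0. Qed.

Lemma profile_mid w w1 w2 : (forall i, w1 i + w2 i = 2 * w i)%N ->
  forall l, (profile w1 l + profile w2 l = 2 * profile w l)%N.
Proof.
by move=> h [|j] //=; case: insubP => [i _ _|_]; rewrite ?h // mul2n addnn.
Qed.

Lemma interpolation_mid w w1 w2 : (forall i, w1 i + w2 i = 2 * w i)%N ->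
  interpolation w1 * interpolation w2 = interpolation w ^+ 2.
Proof.
move=> h; rewrite expr2 /interpolation -!big_split; apply: eq_bigr => l _ /=.
rewrite -!powRD ?(gt_eqF (r_gt0 l)) ?implybT //; congr (_ `^ _).
rewrite /slope -!mulrDl; congr (_ / _).
have [e1 e2] := (profile_mid h l, profile_mid h l.+1).
have {}e1 : (profile w1 l)%:R + (profile w2 l)%:R = 2 * (profile w l)%:R :> R.
  by rewrite -natrD e1 natrM.
have {}e2 : (profile w1 l.+1)%:R + (profile w2 l.+1)%:R = 2 * (profile w l.+1)%:R :> R.
  by rewrite -natrD e2 natrM.
by lra.
Qed.

(** For a step function only the exponent of index l0 is nonzero, and it is 1. *)
Lemma interpolation_step w (l0 : 'I_d.+1) : (forall i, w i = if (i < l0)%N then 1%N else m) ->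
  interpolation w = r l0.
Proof.
move=> h; have pE (l : nat) : (l <= d.+1)%N -> profile w l = if (l <= l0)%N then 1%N else m.
  case: l => [|j] //= jd; case: insubP => [i _ ij|]; first by rewrite h -ij.
  rewrite -leqNgt => dj; rewrite ltnNge (leq_trans _ dj) //; exact: leq_ord.
have m1 : m%:R - 1 != 0 :> R by rewrite subr_eq0 (eqr_nat _ m 1) gtn_eqF.
rewrite /interpolation (bigD1 l0) //= big1 ?mulr1 => [|l ll0].
  rewrite /slope !pE ?ltnS ?leq_ord //; last by apply: leq_trans (leq_ord _) _.
  by rewrite ltnn leqnn divff // powRr1 // ltW.
rewrite /slope !pE ?ltnS ?leq_ord //; last by apply: leq_trans (leq_ord _) _.
have -> : (l < l0)%N = (l <= l0)%N by rewrite ltn_neqAle ll0.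
by rewrite subrr mul0r powRr0.
Qed.

End Bound.

Section Support.
Local Open Scope ring_scope.
Local Open Scope sesquilinear_scope.

Lemma finite_support_bound (R : realType) (d alpha : nat) (a : d.-tuple nat -> 'M[R[i]]_alpha) :
  finite_set [set k | a k != 0]%classic ->
  exists K, forall k, a k <> 0 -> forall j, (tnth k j < K)%N.
Proof.
case/finite_seqP => s sE; exists (\max_(k <- s) \max_(j < d) tnth k j).+1 => k /eqP ak j.
have ks : k \in s by have : [set k | a k != 0]%classic k := ak; rewrite sE.
rewrite ltnS; apply: leq_trans (leq_bigmax_seq _ ks _) => //.
exact: (leq_bigmax j).
Qed.

End Support.

Section Main.
Local Open Scope ring_scope.
Local Open Scope sesquilinear_scope.
Variables (R : realType) (d m alpha : nat).
Hypothesis hm : (2 <= m)%N.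
Local Notation n := (2 * m)%N.
Variables (K : nat) (a : d.-tuple nat -> 'M[R[i]]_alpha).
Hypothesis aK : forall k, a k <> 0 -> forall j, (tnth k j < K)%N.
Variable k0 : d.-tuple nat.
Hypothesis ak0 : a k0 <> 0.

(** The trace whose 2m-th root is the Schatten norm of M_l. *)
Definition trace_power (l : 'I_d.+1) : R[i] := btr (bexp (bmul (badj (M_ a l)) (M_ a l)) m).

Lemma trace_powerE l : trace_power l = ktr (kpow (gram (afin (K := K) a) (l := l)) m).
Proof.
rewrite /trace_power; have -> : m = m.-1.+1 by rewrite prednK // (leq_trans _ hm).
exact: btr_bexp.
Qed.

Lemma trace_power_gt0 l : 0 < trace_power l.
Proof.
rewrite trace_powerE; apply: (@ktr_gt0 _ _ _ _ (fun s t => afin a (mix s t))); last exact: ltnW.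
have [v k0E] := embP (aK ak0); exists (projl l v), (projr l v).
rewrite /afin (_ : mix _ _ = v) -?k0E; first exact/eqP.
by apply/ffunP => i; rewrite mix_proj; case: ifP.
Qed.

Lemma Re_trace_power_gt0 l : 0 < complex.Re (trace_power l).
Proof. by have := trace_power_gt0 l; rewrite ltcE => /andP[]. Qed.

(** The modulus of the sum attached to E, as an element of R. *)
Definition value e (E : 'I_d -> rel 'I_n) : R :=
  complex.Re `|wordsum (afin (K := K) a) e E|.

Lemma valueE e E : `|wordsum (afin (K := K) a) e E| = (value e E)%:C%C.
Proof. by rewrite /value RRe_real // normr_real. Qed.

Lemma value_bound e E : admissible e E ->
  value e E <= interpolation m (fun l => complex.Re (trace_power l)) (opens e E).
Proof.
apply: (@value_le_bound m d hm).
- move=> e' E1 E2 h; rewrite /value /wordsum; congr (complex.Re `|_|).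
  apply: eq_bigl => k; apply/compatibleP/compatibleP => h' i x y; first by rewrite -h; apply: h'.
  by rewrite h; apply: h'.
- move=> e' E'; rewrite -lecR -valueE; exact: normr_ge0.
- by move=> e' E'; rewrite /value wordsum_rot.
- move=> e' E' [eE _ _]; have := wordsum_cauchy_schwarz (afin (K := K) a) eE e'.
  rewrite -(ger0_norm (wordsum_mirror_ge0 _ eE true e')).
  rewrite -(ger0_norm (wordsum_mirror_ge0 _ eE false e')) !valueE.
  by rewrite -rmorphXn -rmorphM lecR.
- move=> o e' E' o0 [eE _ _]; rewrite -lecR -!valueE.
  have ino : inside true o by rewrite /inside o0 (ltnW hm).
  have le := wordsum_isolate (afin (K := K) a) eE (o := o) e' ino.
  have ge0 := wordsum_mirror_ge0 (afin (K := K) a) eE true e'.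
  by rewrite !ger0_norm // (le_trans ge0).
- by move=> w; apply: interpolation_gt0; apply: Re_trace_power_gt0.
- by move=> w w1 w2; apply: interpolation_mid; apply: Re_trace_power_gt0.
- move=> E' [eE al un] gE; have [l lE] := terminal_shape hm eE gE un.
  rewrite (@interpolation_step _ _ _ hm _ _ _ l); last 2 first.
  + exact: Re_trace_power_gt0.
  + move=> i; rewrite ffunE; have nbE (r1 r2 : rel 'I_n) : (forall x y, r1 x y = r2 x y) ->
        nb_open true r1 = nb_open true r2.
      move=> rE; rewrite /nb_open; congr addn; apply: eq_bigr => x _; congr (nat_of_bool (_ && _)).
      by apply: eq_forallb => y; rewrite rE.
    case: ifP => il.
      by rewrite (nbE _ (@near_pairs m)) ?nb_open_near // => x y; rewrite lE il.
    rewrite (nbE _ (@far_pairs m)) ?nb_open_far // => [|| x y]; last by rewrite lE il.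
      exact: ltnW.
    exact: near_alternating.
  rewrite /value (wordsum_terminal hm _ lE) -/(ktr _) -trace_powerE.
  by rewrite ger0_norm // ltW // trace_power_gt0.
Qed.

End Main.

Local Open Scope ring_scope.
Local Open Scope classical_set_scope.

Theorem corollary2p4 (R : realType) (d m alpha : nat)
  (hd : (1 <= d)%N) (hm : (2 <= m)%N)
  (P : {set {set 'I_(2 * d * m)}}) (hP : NCstar P)
  (a : d.-tuple nat -> 'M[R[i]]_alpha)
  (ha : finite_set [set k | a k != 0]) :
  `|S_ a P| <=
  (\prod_(l < d.+1)
     schatten2 (M_ a l) m `^ (2 * m%:R * mu R P l))%:C%C.
Proof.
have [K aK] := finite_support_bound ha.
rewrite (S_wordsum aK hP).
have [[k0 ak0]|none] := pselect (exists k, a k <> 0); last first.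
  have a0 k : a k = 0 by apply: contrapT => ak; apply: none; exists k.
  have n0 : (0 < 2 * m)%N by rewrite muln_gt0 (ltnW hm).
  rewrite /wordsum big1 ?normr0 => [|k _].
    by rewrite ler0c; apply: prodr_ge0 => l _; apply: powR_ge0.
  rewrite /word (prod_factor0 (j := Ordinal n0)) ?mxtrace0 ?mem_index_enum //.
  by rewrite /letter /afin /= a0.
have adm : admissible false (labelled P).
  split; [exact: labelled_equiv|exact: labelled_alternating|].
  by move=> i j; apply: labelled_uncrossed.
rewrite (@valueE R d m alpha K a false (labelled P)) lecR.
apply: le_trans (value_bound hm aK ak0 adm) _; rewrite le_eqVlt; apply/orP; left; apply/eqP.
apply: eq_bigr => l _; rewrite /schatten2 -/(trace_power m a l).
rewrite -powRrM; congr (_ `^ _).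
have m0 : 2 * m%:R != 0 :> R by rewrite mulf_neq0 ?pnatr_eq0 // -lt0n ltnW.
rewrite mulrA mulVf // mul1r.
have pE (j : nat) : (j <= d.+1)%N -> profile m (opens false (labelled P)) j = Bres P j.
  case: j => [|j] //= jd; rewrite /Bres /= eqSS.
  case: insubP => [i id ij|]; last by rewrite -leqNgt => dj; rewrite eqn_leq dj -ltnS jd.
  rewrite ffunE -ij (ltn_eqF (ltn_ord i)); apply/esym.
  apply: Bnum_nb_open; [exact: labelled_equiv|exact: labelled_even| |exact: sim_restr].
  by move=> x y z t xz yt xy yz zt; apply: (labelled_noncrossing hP xz yt).
by rewrite /slope /mu !pE // ltnW.
Qed.
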